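(* Let $\mathcal{U}\subset\mathbb{P}^9=\mathbb{P}(\mathbb{C}[x,y,z]_3)$ be the set of classes $[f]$ of ternary cubic forms such that $E(f)$ is regular and contains an aligned triple, i.e. three distinct collinear points. Let $\mathcal{L}=\overline{\mathcal{U}}\subset\mathbb{P}^9$ be its Zariski closure. Then $\mathcal{L}$ is an irreducible hypersurface of $\mathbb{P}^9$.
   Context: For a nonzero ternary cubic form $f\in\mathbb{C}[x,y,z]_3$, the eigenscheme $E(f)\subset\mathbb{P}^2_{\mathbb{C}}$ is the subscheme defined by the $2\times2$ minors of the matrix $\begin{pmatrix}x&y&z\\ \partial_xf&\partial_yf&\partial_zf\end{pmatrix}$; its points are called eigenpoints. $E(f)$ is called regular if it is reduced of dimension $0$ (it then consists of $7$ points). *)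

(* Defs.v *)
From HB Require Import structures.
From mathcomp Require Import all_boot all_order all_algebra.
From mathcomp Require Import boolp classical_sets reals complex mpoly.

Set Implicit Arguments.
Unset Strict Implicit.
Unset Printing Implicit Defensive.

Import GRing.Theory.
Local Open Scope classical_set_scope.
Local Open Scope ring_scope.

Definition proj (K : fieldType) (V : vectType K) : Type :=
  {U : {vspace V} | \dim U == 1%N}.

Definition pline (K : fieldType) (V : vectType K) (p : proj V) : {vspace V} :=
  val p.

(* Homogeneous polynomials on V are written in the coordinates of the basis
   vbasis {:V}; another basis gives the same Zariski topology.  For F
   homogeneous, vanishing on the whole line (0 included) is the same as
   vanishing at one nonzero vector of it. *)
Definition zvanish (K : fieldType) (V : vectType K)
    (F : {mpoly K[\dim {:V}]}) (p : proj V) : Prop :=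
  forall v : V, v \in pline p -> F.@[fun i => coord (vbasis {:V}) i v] = 0.

Definition zclosed (K : fieldType) (V : vectType K) (Z : set (proj V)) : Prop :=
  exists S : set {mpoly K[\dim {:V}]},
    (forall F, S F -> exists d, F \is d.-homog) /\
    Z = [set p | forall F, S F -> zvanish F p].

Definition zclosure (K : fieldType) (V : vectType K) (A : set (proj V)) :
  set (proj V) := smallest (@zclosed K V) A.

Definition zirreducible (K : fieldType) (V : vectType K) (Z : set (proj V)) :
    Prop :=
  Z !=set0 /\
  forall A B, zclosed A -> zclosed B -> Z `<=` A `|` B -> Z `<=` A \/ Z `<=` B.

Definition hypersurface (K : fieldType) (V : vectType K) (Z : set (proj V)) :
    Prop :=
  exists (d : nat) (F : {mpoly K[\dim {:V}]}),
    [/\ (0 < d)%N, F != 0, F \is d.-homog & Z = [set p | zvanish F p]].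

(* Krull dimension of a closed subset Z: the largest length n of a chain
   c_0 < ... < c_n of irreducible closed subsets of Z. *)
Definition zchain (K : fieldType) (V : vectType K) (Z : set (proj V)) (n : nat)
    : Prop :=
  exists c : 'I_n.+1 -> set (proj V),
    (forall i, [/\ zclosed (c i), zirreducible (c i) & c i `<=` Z]) /\
    (forall i j : 'I_n.+1, (i < j)%N -> c i `<` c j).

Definition zdim (K : fieldType) (V : vectType K) (Z : set (proj V)) (n : nat)
    : Prop :=
  zchain Z n /\ forall m, zchain Z m -> (m <= n)%N.

Definition dehomog (K : fieldType) (n : nat) (k : 'I_n.+1)
    (p : {mpoly K[n.+1]}) : {mpoly K[n]} :=
  p \mPo [tuple (if unlift k j is Some l then 'X_l else 1) | j < n.+1].

Definition ideal_gen (A : comNzRingType) (m : nat) (g : 'I_m -> A) : set A :=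
  [set p | exists a : 'I_m -> A, p = \sum_(j < m) a j * g j].

(* The closed subscheme of P^n cut out by homogeneous polynomials g is covered
   by the spectra of the rings K[y_1..y_n] / (g dehomogenized at x_k = 1),
   k = 0..n; it is reduced iff none of these rings has a nonzero nilpotent. *)
Definition subscheme_reduced (K : fieldType) (n m : nat)
    (g : 'I_m -> {mpoly K[n.+1]}) : Prop :=
  forall (k : 'I_n.+1) (p : {mpoly K[n]}) (e : nat),
    ideal_gen (fun j => dehomog k (g j)) (p ^+ e) ->
    ideal_gen (fun j => dehomog k (g j)) p.

Definition subscheme_points (K : fieldType) (n m : nat)
    (g : 'I_m -> {mpoly K[n.+1]}) : set (proj 'rV[K]_n.+1) :=
  [set p | forall (j : 'I_m) (v : 'rV[K]_n.+1),
     v \in pline p -> (g j).@[v 0] = 0].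

Definition eigen_mx (K : fieldType) (f : {mpoly K[3]}) :
    'M[{mpoly K[3]}]_(2, 3) :=
  \matrix_(r < 2, j < 3) (if r == 0 then 'X_j else f^`M(j)).

Definition eigen_minor (K : fieldType) (f : {mpoly K[3]}) (j : 'I_3) :
    {mpoly K[3]} :=
  \det (col' j (eigen_mx f)).

Definition eigenpoints (K : fieldType) (f : {mpoly K[3]}) :
  set (proj 'rV[K]_3) := subscheme_points (eigen_minor f).

(* For K algebraically closed, the closed subsets of the scheme E(f) correspond
   to those of its set of K-points, so both have the same dimension. *)
Definition eigen_regular (K : fieldType) (f : {mpoly K[3]}) : Prop :=
  subscheme_reduced (eigen_minor f) /\ zdim (eigenpoints f) 0.

Definition collinear3 (K : fieldType) (V : vectType K) (p q r : proj V) : Prop :=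
  exists L : {vspace V},
    [/\ \dim L = 2%N, (pline p <= L)%VS, (pline q <= L)%VS & (pline r <= L)%VS].

Definition aligned_triple (K : fieldType) (V : vectType K)
    (E : set (proj V)) : Prop :=
  exists p q r : proj V,
    [/\ E p, E q & E r] /\ [/\ p <> q, p <> r & q <> r] /\ collinear3 p q r.

Definition aligned_cubics (K : fieldType) : set (proj (dhomog 3 K 3)) :=
  [set c | exists f : dhomog 3 K 3,
     [/\ f != 0, pline c = <[f]>%VS, eigen_regular f
       & aligned_triple (eigenpoints f)]].

Arguments aligned_cubics K : clear implicits.

(* Main.v *)
(* Let X be the cone of cubic forms whose gradient, at all points of some plane,
   is orthogonal to the normal of this plane.  A cubic with an aligned triple of
   eigenpoints lies in X, since the restriction of the normal derivative to the
   plane is a quadratic form vanishing on three lines.  Solving the linear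
   conditions on f by Cramer's rule gives a polynomial surjection from an affine
   space onto X, so the ideal of X is prime.  Discriminants of resultants give a
   polynomial on this affine space whose nonvanishing makes the eigenscheme
   regular with three eigenpoints on the plane, and it is nonzero for one explicit
   cubic; so the cubics of the theorem are dense in X.

   It remains to see that the ideal of X is principal and nonzero.  The conditions
   on the normal n are quartic in n and linear in f, and fifteen of them give a
   Macaulay determinant of degree 15 in f vanishing on X.  It does not vanish at
   d = x^3 + xyz + 2y^3, hence is monic in the direction d, and Gauss' lemma gives
   a generator provided that no nonzero H in the ideal is invariant under
   translation by d.  This holds because curves in X through x^3 + y^3, together
   with d, realise all tangent vectors. *)

Require Import Defs.
From HB Require Import structures.
From mathcomp Require Import all_boot all_order all_algebra.
From mathcomp Require Import ring separable perm.
From mathcomp Require Import boolp classical_sets reals complex mpoly.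

Set Implicit Arguments.
Unset Strict Implicit.
Unset Printing Implicit Defensive.

Import GRing.Theory Num.Theory.
Local Open Scope classical_set_scope.
Local Open Scope ring_scope.

(** * Polynomials monic in a direction *)

(** The point x^3 + y^3 and the direction d are matched. Along the curves in X constructed at this
    point every coefficient has a free first order term, except that of xyz, which has none; d has
    xyz coefficient 1 and fills the gap. This coefficient is also the last coordinate, the one that
    a shear normalises to 1. The factor 2 of y^3 keeps d off X. Regularity is reached by
    elimination. In each of the three affine charts and for each of the two coordinates, a resultant
    of two equations of the eigenscheme is a polynomial in this coordinate alone, of degree at most
    7. If all six are separable, the ideal of each chart contains a separable polynomial in each
    variable, so it is radical with finitely many zeros. This can be tested on a cubic whose seven
    eigenpoints are rational. Primality and density are argued for functions that are polynomial on
    every line of the parameter space. Two points always lie on a line, so the determinants in the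
    46 parameters need not be expanded. *)

Lemma poly_eq0_eval (K : numDomainType) (p : {poly K}) :
  (forall t, p.[t] = 0) -> p = 0.
Proof.
move=> h; apply/eqP; apply: contraT => p0; pose r := [seq (i%:R : K) | i <- iota 0 (size p)].
have ur : uniq r by rewrite map_inj_uniq ?iota_uniq // => i j /eqP; rewrite eqr_nat => /eqP.
have rr : all (root p) r by apply/allP => t _; rewrite /root h.
by have := max_poly_roots p0 rr ur; rewrite size_map size_iota ltnn.
Qed.

Section TopCoef.
Variable R : comNzRingType.

(* The coefficient c may vanish. *)
Definition topc (k : nat) (c : R) (p : {poly R}) := (size p <= k.+1)%N /\ p`_k = c.

Lemma topcM k l c d p q : topc k c p -> topc l d q -> topc (k + l) (c * d) (p * q).
Proof.
move=> [sp cp] [sq cq]; split.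
  apply: leq_trans (size_polyMleq _ _) _.
  by rewrite -subn1 leq_subLR add1n -addnS -addSn leq_add.
rewrite coefM (bigD1 (inord k)) //= inordK ?ltnS ?leq_addr // addKn cp cq.
rewrite big1 ?addr0 // => i ik.
have {}ik : i != k :> nat by apply: contra ik => /eqP e; apply/eqP/val_inj; rewrite /= inordK ?ltnS ?leq_addr.
case: (ltngtP i k) ik => // ik _.
  rewrite [q`_ _]nth_default ?mulr0 //; apply: leq_trans sq _.
  by rewrite ltn_subRL ltn_add2r.
by rewrite [p`_ _]nth_default ?mul0r //; apply: leq_trans sp _.
Qed.

Lemma topc1 : topc 0 1 1.
Proof. by split; rewrite ?coefC // size_polyC oner_eq0. Qed.

Lemma topc_exp k c p m : topc k c p -> topc (k * m) (c ^+ m) (p ^+ m).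
Proof.
move=> h; elim: m => [|m IH]; first by rewrite muln0 !expr0; apply: topc1.
by rewrite mulnS !exprS; apply: topcM.
Qed.

Lemma topc_prod (I : Type) (r : seq I) (k : I -> nat) c p :
  (forall i, topc (k i) (c i) (p i)) ->
  topc (\sum_(i <- r) k i) (\prod_(i <- r) c i) (\prod_(i <- r) p i).
Proof.
move=> h; elim: r => [|i r IH]; first by rewrite !big_nil; apply: topc1.
by rewrite !big_cons; apply: topcM.
Qed.

End TopCoef.

Section Shear.
Variables (K : comNzRingType) (n : nat) (d : 'I_n -> K).

Definition dir (i : 'I_n.+1) : K := if unlift ord_max i is Some j then d j else 1.

(** The substitution x_j = y_j + d_j t, x_n = t: [dir d] becomes the direction of the variable t,
    and the y_j are constant along it. *)
Definition shear_var (i : 'I_n.+1) : {poly {mpoly K[n]}} :=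
  if unlift ord_max i is Some j then ('X_j)%:P + (d j)%:MP *: 'X else 'X.

Definition shear : {mpoly K[n.+1]} -> {poly {mpoly K[n]}} :=
  mmap (polyC \o @mpolyC n K) shear_var.

HB.instance Definition _ :=
  GRing.RMorphism.copy shear (mmap (polyC \o @mpolyC n K) shear_var).

Definition unshear_coef : {mpoly K[n]} -> {mpoly K[n.+1]} :=
  mmap (@mpolyC n.+1 K) (fun j => 'X_(lift ord_max j) - d j *: 'X_ord_max).

HB.instance Definition _ := GRing.RMorphism.copy unshear_coef
  (mmap (@mpolyC n.+1 K) (fun j => 'X_(lift ord_max j) - d j *: 'X_ord_max)).

Definition unshear : {poly {mpoly K[n]}} -> {mpoly K[n.+1]} :=
  horner_eval 'X_ord_max \o map_poly unshear_coef.

HB.instance Definition _ := GRing.RMorphism.copy unshear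
  (horner_eval 'X_ord_max \o map_poly unshear_coef).

Arguments shear : simpl never.
Arguments unshear : simpl never.
Arguments unshear_coef : simpl never.

Lemma shearC c : shear c%:MP = (c%:MP)%:P.
Proof. by rewrite /shear mmapC. Qed.

Lemma shearXU i : shear 'X_i = shear_var i.
Proof. by rewrite /shear mmapX mmap1U. Qed.

Lemma unshearC c : unshear c%:P = unshear_coef c.
Proof. by rewrite /unshear /= /horner_eval map_polyC /= hornerC. Qed.

Lemma unshear_var i : unshear (shear_var i) = 'X_i.
Proof.
have uX : unshear 'X = 'X_ord_max.
  by rewrite /unshear /= /horner_eval map_polyX hornerX.
rewrite /shear_var; case: unliftP => [j|] -> //.
rewrite -mul_polyC rmorphD rmorphM /= uX !unshearC /unshear_coef mmapX mmap1U mmapC.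
by rewrite mul_mpolyC subrK.
Qed.

Lemma shearK : cancel shear unshear.
Proof.
move=> p; transitivity (\sum_(m <- msupp p) p@_m *: 'X_[m]); last by rewrite -mpolyE.
transitivity (unshear (shear (\sum_(m <- msupp p) p@_m *: 'X_[m]))); first by rewrite -mpolyE.
rewrite (rmorph_sum shear) /= (rmorph_sum unshear) /=; apply: eq_bigr => m _; rewrite -mul_mpolyC !rmorphM /= shearC unshearC.
rewrite {1}/unshear_coef mmapC; congr (_ * _).
rewrite (mpolyXE_id _ m) !rmorph_prod /=; apply: eq_bigr => i _.
by rewrite !rmorphXn /= shearXU unshear_var.
Qed.

Lemma meval_unshear (P : {poly {mpoly K[n]}}) (x : 'I_n.+1 -> K) :
  (unshear P).@[x] =
  (map_poly (meval (fun j => x (lift ord_max j) - d j * x ord_max)) P).[x ord_max].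
Proof.
set y := fun j => _; elim/poly_ind: P => [|P c IH]; first by rewrite !rmorph0 horner0.
have uX : unshear 'X = 'X_ord_max.
  by rewrite /unshear /= /horner_eval map_polyX hornerX.
rewrite !rmorphD !rmorphM /= uX IH map_polyX map_polyC hornerD hornerMX hornerC /=.
rewrite mevalXU; congr (_ + _); rewrite unshearC.
rewrite /unshear_coef /mmap rmorph_sum mevalE; apply: eq_bigr => m _.
rewrite rmorphM /= mevalC /mmap1 rmorph_prod; congr (_ * _); apply: eq_bigr => i _.
by rewrite rmorphXn /= mevalB mevalZ !mevalXU.
Qed.

Lemma meval_shear H (x : 'I_n.+1 -> K) :
  H.@[x] =
  (map_poly (meval (fun j => x (lift ord_max j) - d j * x ord_max)) (shear H)).[x ord_max].
Proof. by rewrite -meval_unshear shearK. Qed.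

(** A sheared monomial has degree at most its total degree in the new variable, and its coefficient
    there is its value at [dir d]; so only the part of degree k reaches the coefficient of index
    k. *)
Lemma topc_shear k H : (msize H <= k.+1)%N ->
  topc k ((pihomog mdeg k H).@[dir])%:MP (shear H).
Proof.
move=> sH.
have X1 m : topc (mdeg m) ((\prod_i dir i ^+ m i)%:MP) (shear 'X_[m]).
  rewrite /shear mmapX /mmap1 rmorph_prod mdegE.
  apply: topc_prod => i; rewrite rmorphXn -[X in topc X]mul1n; apply: topc_exp.
  rewrite /shear_var /dir; case: unlift => [j|]; split.
  - apply: leq_trans (size_polyD _ _) _; rewrite geq_max size_polyC.
    by apply/andP; split; [case: (_ != 0)|apply: leq_trans (size_scale_leq _ _) _; rewrite size_polyX].
  - by rewrite coefD coefC coefZ coefX add0r mulr1.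
  - by rewrite size_polyX.
  - by rewrite coefX.
have -> : shear H = \sum_(m <- msupp H) (H@_m)%:MP *: shear 'X_[m].
  transitivity (shear (\sum_(m <- msupp H) H@_m *: 'X_[m])); first by rewrite -mpolyE.
  rewrite (rmorph_sum shear) /=; apply: eq_bigr => m _.
  by rewrite -mul_mpolyC rmorphM /= shearC mul_polyC.
have -> : (pihomog mdeg k H).@[dir] =
    \sum_(m <- msupp H) if mdeg m == k then H@_m * \prod_i dir i ^+ m i else 0.
  rewrite pihomogE rmorph_sum big_mkcond /=; apply: eq_bigr => m _.
  by case: eqP => // _; rewrite mevalZ mevalX.
have : all (fun m => (mdeg m <= k)%N) (msupp H).
  by apply/allP => m mH; rewrite -ltnS (leq_trans (msize_mdeg_lt mH)).
elim: (msupp H) => [|m r IH] /=.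
  by rewrite !big_nil; split; rewrite ?size_poly0 ?coef0.
move=> /andP[mk /IH [s1 c1]]; rewrite !big_cons; have [s2 c2] := X1 m; split.
  apply: leq_trans (size_polyD _ _) _; rewrite geq_max s1 andbT.
  by apply: leq_trans (size_scale_leq _ _) _; apply: leq_trans s2 _.
rewrite coefD c1 coefZ mpolyCD; congr (_ + _); case: eqP => [<-|nk].
  by rewrite c2 mpolyCM.
rewrite nth_default ?mulr0 //; apply: leq_trans s2 _.
by rewrite ltn_neqAle mk andbT; apply/eqP.
Qed.

End Shear.

Lemma mpoly_eq0_eval (K : numDomainType) n (H : {mpoly K[n]}) :
  (forall x, H.@[x] = 0) -> H = 0.
Proof.
elim: n H => [|n IH] H H0.
  have := H0 (fun=> 0); rewrite mevalE => e; apply/mpolyP => m; rewrite mcoeff0.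
  have m0 (m' : 'X_{1.. 0}) : m' = 0%MM by apply/mnmP => -[].
  have [|] := boolP (m \in msupp H); last by rewrite mcoeff_msupp negbK => /eqP.
  move=> mH; move: e; rewrite (bigD1_seq m) ?msupp_uniq //= big_ord0 mulr1.
  by rewrite big1 ?addr0 // => m'; rewrite (m0 m') (m0 m) eqxx.
(* With direction coefficients 0 the shear only singles out the last variable. *)
rewrite -(shearK (fun=> 0) H); suff -> : shear (fun=> 0) H = 0 by rewrite rmorph0.
apply/polyP => i; rewrite coef0; apply: IH => y.
pose x t (i : 'I_n.+1) := if unlift ord_max i is Some j then y j else t.
have := congr1 (fun p : {poly K} => p`_i) (poly_eq0_eval (p := map_poly (meval y) (shear (fun=> 0) H)) _).
rewrite coef_map coef0; apply => t.
have := H0 (x t); rewrite (meval_shear (fun=> 0)) /x unlift_none => e.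
rewrite -[RHS]e; congr (_.[_]); apply: eq_map_poly => p; apply: meval_eq => j.
by rewrite mul0r subr0 liftK.
Qed.

Lemma meval_dhomog (K : comNzRingType) n k (H : {mpoly K[n]}) (c : K) x :
  H \is k.-homog -> H.@[fun i => c * x i] = c ^+ k * H.@[x].
Proof.
move=> hH; rewrite mevalE [in RHS]mevalE big_distrr /= !big_seq; apply: eq_bigr => m mH.
rewrite mulrCA; congr (_ * _); rewrite -(dhomogP _ _ _ hH _ mH).
under eq_bigr do rewrite exprMn.
by rewrite big_split /= mdegE (big_morph _ (exprD c) (expr0 c)).
Qed.

Lemma exists_dir (K : numFieldType) n (H : {mpoly K[n.+1]}) : H != 0 ->
  exists d, (pihomog mdeg (msize H).-1 H).@[dir d] != 0.
Proof.
move=> H0; set k := _.-1; set T := pihomog _ _ _.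
have T0 : T != 0.
  have : T@_(mlead H) != 0.
    have mH := mlead_supp H0; rewrite /T pihomogE big_mkcond raddf_sum /=.
    rewrite (bigD1_seq (mlead H)) ?msupp_uniq //= big1 => [|m' /negPf m'H].
      by rewrite -/k /k -(mlead_deg H0) eqxx mcoeffZ mcoeffX eqxx mulr1 addr0 mleadc_eq0.
    by case: ifP => _; rewrite ?mcoeff0 // mcoeffZ mcoeffX m'H mulr0.
  by apply: contra => /eqP ->; rewrite mcoeff0.
have hT : T \is k.-homog by apply: pihomogP.
(* The extra factor forces a nonzero last coordinate, so the point can be rescaled to the form
   [dir d]. *)
have [x xT] : exists x, (T * 'X_ord_max).@[x] != 0.
  apply/not_existsP => h; have /mpoly_eq0_eval/eqP : forall x, (T * 'X_ord_max).@[x] = 0.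
    by move=> x; apply/eqP/negPn/negP; apply: h.
  rewrite mulf_eq0 (negPf T0) /= => /eqP/(congr1 (mcoeff U_(ord_max))).
  by rewrite mcoeffX eqxx mcoeff0 => /eqP; rewrite oner_eq0.
move: xT; rewrite mevalM mevalXU mulf_eq0 negb_or => /andP[Tx xm].
exists (fun j => x (lift ord_max j) / x ord_max).
have : T.@[fun i => (x ord_max)^-1 * x i] != 0.
  by rewrite (meval_dhomog _ _ hT) mulf_neq0 // expf_neq0 // invr_eq0.
congr (_ != 0); apply: meval_eq => i; rewrite /dir; case: unliftP => [j|] ->.
  by rewrite mulrC.
by rewrite mulVf.
Qed.

(** A linear factor of [a] divides P * Q. Modulo it the coefficients lie in a field, so it divides
    all coefficients of P or all those of Q, and is cancelled. Once [a] is constant, the leading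
    coefficient of P is a unit. *)
Lemma gauss_closed (K : closedFieldType) (a : {poly K}) (P Q F : {poly {poly K}}) :
  a != 0 -> F \is monic -> a *: F = P * Q -> exists P', P = lead_coef P *: P'.
Proof.
elim: {a}(size a) {-2}a (erefl (size a)) P Q => [|s IH] a sa P Q a0 mF e.
  by move/eqP: sa; rewrite size_poly_eq0 (negPf a0).
have lPQ : lead_coef P * lead_coef Q = a.
  by rewrite -lead_coefM -e lead_coefZ (monicP mF) mulr1.
have [s1|s1] := eqVneq (size a) 1%N.
  have : a \is a GRing.unit by rewrite poly_unitE s1 eqxx unitfE -lead_coef_eq0 lead_coefE s1 in a0 *.
  rewrite -lPQ unitrM => /andP[uP _].
  by exists ((lead_coef P)^-1 *: P); rewrite scalerA divrr ?scale1r.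
have [x /factor_theorem [a' ea]] := closed_rootP a s1.
have a'0 : a' != 0 by apply: contraNneq a0 => a'0; rewrite ea a'0 mul0r.
have sa' : size a' = s.
  by move: sa; rewrite ea size_Mmonic ?monicXsubC // size_XsubC addn2 => -[].
have X0 : 'X - x%:P != 0 :> {poly K} by rewrite polyXsubC_eq0.
have can (R1 R2 : {poly {poly K}}) : ('X - x%:P) *: R1 = ('X - x%:P) *: R2 -> R1 = R2.
  by rewrite -!mul_polyC => /mulfI; apply; rewrite polyC_eq0.
pose ev := map_poly (horner_eval x) : {poly {poly K}} -> {poly K}.
have div R : ev R = 0 -> exists R', R = ('X - x%:P) *: R'.
  move=> eR; exists (\poly_(i < size R) (R`_i %/ ('X - x%:P))).
  apply/polyP => i; rewrite coefZ coef_poly; case: ltnP => [_|si]; last first.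
    by rewrite mulr0 nth_default.
  rewrite mulrC divpK // dvdp_XsubCl /root.
  by have := congr1 (fun p : {poly K} => p`_i) eR; rewrite coef_map coef0 /= /horner_eval => ->.
have evZ b R : ev (b *: R) = b.[x] *: ev R.
  by apply/polyP => i; rewrite coefZ !coef_map /= coefZ /horner_eval hornerM.
have : ev P * ev Q == 0.
  have <- : ev (P * Q) = ev P * ev Q by rewrite /ev rmorphM.
  by rewrite -e evZ ea hornerM hornerXsubC subrr mulr0 scale0r.
rewrite mulf_eq0 => /orP[] /eqP/div [R eR].
  have [|P' eP'] := IH a' sa' R Q a'0 mF.
    apply: can.
    by rewrite scalerA mulrC -ea e eR scalerAl.
  by exists P'; rewrite eR {1}eP' lead_coefZ scalerA.
have [|P' eP'] := IH a' sa' P R a'0 mF; last by exists P'.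
apply: can.
by rewrite scalerA mulrC -ea e eR scalerAr.
Qed.

(* After a shear the leading coefficient of P becomes monic in one variable, so
   divisibility by it can be tested after specialising the other variables to
   constants, where [gauss_closed] applies. *)
Lemma gauss_mpoly (K : numClosedFieldType) n (a : {mpoly K[n.+1]})
    (P Q F : {poly {mpoly K[n.+1]}}) :
  a != 0 -> F \is monic -> a *: F = P * Q -> exists P', P = lead_coef P *: P'.
Proof.
move=> a0 mF e; set c := lead_coef P.
have lPQ : c * lead_coef Q = a.
  by rewrite -lead_coefM -e lead_coefZ (monicP mF) mulr1.
have [d al0'] := exists_dir a0; set k := _.-1 in al0'.
have sa0 : (0 < msize a)%N by rewrite lt0n msize_poly_eq0.
have [al al0 [sa la]] : exists2 al, al != 0 & topc k al%:MP (shear d a).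
  by exists ((pihomog mdeg k a).@[dir d]) => //; apply: topc_shear; rewrite prednK.
have alC0 : al%:MP_[n] != 0 by rewrite mpolyC_eq0.
have lsa : lead_coef (shear d a) = al%:MP.
  rewrite lead_coefE; suff -> : size (shear d a) = k.+1 by [].
  apply/eqP; rewrite eqn_leq sa /= ltnNge; apply: contra alC0 => h.
  by rewrite -la nth_default.
(* The sheared product [a = c * lead_coef Q] has the nonzero constant [al] as leading coefficient,
   so that of the sheared [c] is a unit, with inverse [v]. *)
pose u := lead_coef (shear d c); pose v := lead_coef (shear d (lead_coef Q)) * (al^-1)%:MP.
have uv : u * v = 1.
  have eM : shear d a = shear d c * shear d (lead_coef Q) by rewrite -lPQ [LHS]rmorphM.
  by rewrite mulrA -lead_coefM -eM lsa -mpolyCM divff.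
pose c1 := v *: shear d c.
have mc1 : c1 \is monic by rewrite monicE lead_coefZ mulrC uv.
have cE : shear d c = u *: c1 by rewrite scalerA uv scale1r.
have key i : Pdiv.Ring.rmodp (shear d P`_i) c1 = 0.
  set r := Pdiv.Ring.rmodp _ _.
  have dE := Pdiv.RingMonic.rdivp_eq mc1 (shear d P`_i); rewrite -/r in dE.
  have sr : (size r < size c1)%N by rewrite Pdiv.Ring.ltn_rmodpN0 // monic_neq0.
  apply/polyP => j; rewrite coef0; apply: mpoly_eq0_eval => y.
  pose ev := map_poly (meval y) \o shear d.
  have [|||P' eP] := @gauss_closed K (ev a) (map_poly ev P) (map_poly ev Q) (map_poly ev F).
  - rewrite -lead_coef_eq0 /ev /= lead_coef_map_id0 ?rmorph0 // lsa /= mevalC //.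
  - exact: monic_map.
  - by rewrite -map_polyZ e rmorphM.
  have evc0 : ev c != 0.
    have h : ev a = ev c * ev (lead_coef Q) by rewrite -lPQ [LHS]rmorphM.
    have : ev a != 0.
      by rewrite -lead_coef_eq0 /ev /= lead_coef_map_id0 ?rmorph0 // lsa /= mevalC.
    by apply: contraNneq => c0; rewrite h c0 mul0r.
  have lP : lead_coef (map_poly ev P) = ev c.
    by apply: lead_coef_map_id0 => //; rewrite /ev /= !rmorph0.
  have ePi : ev P`_i = ev c * P'`_i.
    have ev0 : ev 0 = 0 by rewrite /ev /= !rmorph0.
    have := congr1 (fun p : {poly {poly K}} => p`_i) eP.
    by rewrite coefZ lP coef_map_id0.
  have mcy : map_poly (meval y) c1 \is monic by apply: monic_map.
  have : map_poly (meval y) c1 %| map_poly (meval y) r.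
    have -> : map_poly (meval y) r = ev P`_i -
        map_poly (meval y) (Pdiv.Ring.rdivp (shear d P`_i) c1) * map_poly (meval y) c1.
      by rewrite /ev /= {1}dE rmorphD rmorphM /= addrC addKr.
    rewrite dvdp_sub ?dvdp_mull // ePi dvdp_mulr // /ev /= cE -mul_polyC rmorphM /=.
    by rewrite dvdp_mull.
  move=> /dvdp_leq h.
  (* As [c1] is monic, specialisation keeps its degree; a remainder of smaller degree that it
     divides must vanish. *)
  suff r0 : map_poly (meval y) r = 0.
    by have := congr1 (fun p : {poly K} => p`_j) r0; rewrite coef_map coef0.
  apply/eqP/negPn/negP => r0; have := h r0; rewrite leqNgt => /negP [].
  apply: leq_ltn_trans (size_poly _ _) _; apply: leq_trans sr _.
  rewrite -(prednK (n := size c1)) ?lt0n ?size_poly_eq0 ?monic_neq0 // ltnNge.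
  apply/negP => /leq_sizeP /(_ _ (leqnn _)); rewrite coef_map /= -lead_coefE.
  by rewrite (monicP mc1) meval1 => /eqP; rewrite oner_eq0.
exists (\poly_(i < size P) unshear d (Pdiv.Ring.rdivp (shear d P`_i) c1 * v%:P)).
apply/polyP => i; rewrite coefZ coef_poly; case: ltnP => [_|si]; last first.
  by rewrite mulr0 nth_default.
rewrite -[LHS](shearK d) -[c](shearK d) -[RHS](rmorphM (unshear d)); congr (unshear d _).
have := Pdiv.RingMonic.rdivp_eq mc1 (shear d P`_i); rewrite key addr0 => dE.
by rewrite {1}dE {2}/c1 -mul_polyC mulrA [RHS]mulrC.
Qed.

(** On the line through 0 and x, H is a polynomial in the scaling factor c whose coefficients are
    the values at x of the homogeneous parts. *)
Lemma pihomog_vanish (K : numFieldType) n (X : ('I_n -> K) -> Prop) (H : {mpoly K[n]}) k :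
  (forall c x, X x -> X (fun i => c * x i)) ->
  (forall x, X x -> H.@[x] = 0) -> forall x, X x -> (pihomog mdeg k H).@[x] = 0.
Proof.
move=> sX HX x Xx.
pose p := \sum_(j < (msize H).+1) (pihomog mdeg j H).@[x] *: 'X^j : {poly K}.
have p0 : p = 0.
  apply: poly_eq0_eval => c; rewrite /p horner_sum.
  transitivity (H.@[fun i => c * x i]); last by apply/HX/sX.
  rewrite [in RHS](pihomog_partitionE (mf := mdeg) (leqnSn (msize H))) rmorph_sum /=.
  by apply: eq_bigr => j _; rewrite hornerZ hornerXn (meval_dhomog _ _ (pihomogP mdeg j H)) mulrC.
have [kH|Hk] := ltnP k (msize H).+1.
  have := congr1 (fun q : {poly K} => q`_k) p0; rewrite coef0 coef_sum => <-.
  rewrite (bigD1 (Ordinal kH)) //= coefZ coefXn eqxx mulr1 big1 ?addr0 // => j jk.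
  rewrite coefZ coefXn; case: eqP => [e|]; last by rewrite mulr0.
  by case/eqP: jk; apply: val_inj.
rewrite pihomogE big1_seq ?meval0 // => m /andP[/eqP e mH].
by have := msize_mdeg_lt mH; rewrite e ltnNge (ltnW Hk).
Qed.

Lemma msize_dhomog (R : nzRingType) n k (H : {mpoly R[n]}) :
  H \is k.-homog -> (msize H <= k.+1)%N.
Proof.
move=> hH; have [->|H0] := eqVneq H 0; first by rewrite msize0.
by rewrite -(mlead_deg H0) (dhomogP _ _ _ hH) ?mlead_supp.
Qed.

(** * A principal prime ideal *)

(* The last hypothesis says that J contains no nonzero polynomial which is
   constant in the direction d.  In sheared coordinates F0 is monic up to a unit
   in that direction, so a member of J of minimal positive degree divides F0 up
   to a factor free of the last variable, which Gauss' lemma removes. *)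
Lemma hypersurface_generator (K : numClosedFieldType) n (X : ('I_n.+2 -> K) -> Prop)
    (J := fun H : {mpoly K[n.+2]} => forall x, X x -> H.@[x] = 0)
    (F0 : {mpoly K[n.+2]}) k (d : 'I_n.+1 -> K) :
  (exists x, X x) ->
  (forall c x, X x -> X (fun i => c * x i)) ->
  (forall G H, J (G * H) -> J G \/ J H) ->
  J F0 -> F0 \is k.-homog -> F0.@[dir d] != 0 ->
  (forall H, J H -> (forall x t, H.@[fun i => x i + t * dir d i] = H.@[x]) -> H = 0) ->
  exists e M, [/\ (0 < e)%N, M != 0, M \is e.-homog, J M
                & forall H, J H -> exists Q, H = Q * M].
Proof.
move=> [x0 Xx0] sX prJ JF0 hF0 F0d inv.
pose J' P := J (unshear d P).
have JM G H : J H -> J (G * H) by move=> h x Xx; rewrite mevalM h ?mulr0.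
have J'M P Q : J' Q -> J' (P * Q).
  by move=> h; rewrite /J'; have -> : unshear d (P * Q) = unshear d P * unshear d Q; [exact: rmorphM|apply: JM].
have J'B P Q : J' P -> J' Q -> J' (P - Q).
  move=> h1 h2 x Xx; have -> : unshear d (P - Q) = unshear d P - unshear d Q by exact: rmorphB.
  by rewrite mevalB h1 ?h2 ?subr0.
have J'pr P Q : J' (P * Q) -> J' P \/ J' Q.
  by rewrite /J'; have -> : unshear d (P * Q) = unshear d P * unshear d Q; [exact: rmorphM|apply: prJ].
have J'Z a P : J' P -> J' (a *: P) by rewrite -mul_polyC; apply: J'M.
(* A polynomial free of the sheared variable is invariant along [dir d]. *)
have J'C h : J' h%:P -> h = 0.
  move=> Jh; have e x : (unshear d h%:P).@[x] = h.@[fun j => x (lift ord_max j) - d j * x ord_max].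
    by rewrite meval_unshear map_polyC hornerC.
  have h0 : unshear d h%:P = 0.
    apply: inv => // x t; rewrite !e; apply: meval_eq => j.
    by rewrite /dir liftK unlift_none; ring.
  apply: mpoly_eq0_eval => y.
  pose x (i : 'I_n.+2) := if unlift ord_max i is Some j then y j else 0.
  have := e x; rewrite h0 meval0 => ->; apply: meval_eq => j.
  by rewrite /x liftK unlift_none mulr0 subr0.
have sF0 := msize_dhomog hF0.
have [s1 c1] := topc_shear d sF0.
rewrite pihomog_dE // in c1; move: (F0.@[_]) F0d c1 => al al0 c1.
pose F1 := (al^-1)%:MP *: shear d F0.
have lF1 : F1`_k = 1 by rewrite coefZ c1 -mpolyCM mulVf.
have mF1 : F1 \is monic.
  have sk : size F1 = k.+1.
    apply/eqP; rewrite eqn_leq (leq_trans (size_scale_leq _ _)) //= ltnNge.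
    by apply/negP => /leq_sizeP /(_ k (leqnn k)) /eqP; rewrite lF1 oner_eq0.
  by rewrite monicE lead_coefE sk /= lF1.
have JF1 : J' F1 by apply: J'Z; rewrite /J' shearK.
pose S s := `[< exists P, [/\ J' P, P != 0 & size P = s] >].
have exS : exists s, S s.
  by exists (size F1); apply/asboolP; exists F1; rewrite monic_neq0.
have [m0 [Jm0 m00 sm0]] : exists P, [/\ J' P, P != 0 & size P = ex_minn exS].
  by case: ex_minnP => s /asboolP.
have min P : J' P -> (size P < size m0)%N -> P = 0.
  move=> JP; rewrite sm0; case: ex_minnP => s _ h; rewrite ltnNge => /negP sP.
  by apply/eqP/negPn/negP => P0; apply/sP/h/asboolP; exists P.
have lm0 : lead_coef m0 != 0 by rewrite lead_coef_eq0.
have dv := Pdiv.Idomain.divp_eq F1 m0.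
set Q := Pdiv.Idomain.divp _ _ in dv; set r := Pdiv.Idomain.modp _ _ in dv.
have r0 : r = 0.
  apply: min; last by apply: Pdiv.Idomain.ltn_modpN0.
  have -> : r = lead_coef m0 ^+ Pdiv.Idomain.scalp F1 m0 *: F1 - Q * m0 by rewrite dv addrC addKr.
  by apply: J'B; [apply: J'Z|apply: J'M].
rewrite r0 addr0 mulrC in dv.
have [m em] := gauss_mpoly (expf_neq0 _ lm0) mF1 dv.
(* By primality: the other factor [lead_coef m0] is nonzero and free of the sheared variable, hence
   outside the ideal. *)
have Jm : J' m.
  move: Jm0; rewrite em -mul_polyC => /J'pr [/J'C|//] /eqP; by rewrite (negPf lm0).
have sm : size m = size m0 by rewrite [in RHS]em size_scale.
have mm : m \is monic.
  rewrite monicE -(inj_eq (mulfI lm0)) mulr1.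
  by rewrite -lead_coefZ -em.
pose M := unshear d m.
have div H : J H -> exists Q, H = Q * M.
  move=> JH; have := Pdiv.RingMonic.rdivp_eq mm (shear d H).
  set q := Pdiv.Ring.rdivp _ _; set r1 := Pdiv.Ring.rmodp _ _ => e.
  have r10 : r1 = 0.
    apply: min; last by rewrite -sm Pdiv.Ring.ltn_rmodpN0 // monic_neq0.
    have -> : r1 = shear d H - q * m by rewrite e addrC addKr.
    by apply: J'B; [rewrite /J' shearK|apply: J'M].
  exists (unshear d q); rewrite -[LHS](shearK d) e r10 addr0; exact: rmorphM.
have M0 : M != 0.
  have [Q0 e] := div _ JF0; apply: contraNneq al0 => M0.
  have := c1; rewrite e M0 mulr0 rmorph0 coef0 => /esym/eqP.
  by rewrite mpolyC_eq0.
(* Homogeneity of M: X being a cone, each homogeneous part of M is in J, so a nonzero one is a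
   multiple of M and has at least its degree. *)
have deg m1 m2 : m1 \in msupp M -> m2 \in msupp M -> (mdeg m2 <= mdeg m1)%N.
  move=> h1 h2; pose Mj := pihomog mdeg (mdeg m1) M.
  have Mj0 : Mj != 0.
    have : Mj@_m1 != 0.
      rewrite /Mj pihomogE big_mkcond raddf_sum /= (bigD1_seq m1) ?msupp_uniq //=.
      rewrite eqxx mcoeffZ mcoeffX eqxx mulr1 big1 ?addr0 -?mcoeff_msupp // => m' /negPf m'1.
      by case: ifP => _; rewrite ?mcoeff0 // mcoeffZ mcoeffX m'1 mulr0.
    by apply: contra => /eqP ->; rewrite mcoeff0.
  have [Q1 eQ] := div Mj (@pihomog_vanish _ _ X M _ sX Jm).
  have Q10 : Q1 != 0 by apply: contraNneq Mj0 => Q10; rewrite eQ Q10 mul0r.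
  have : (msize M <= msize Mj)%N.
    rewrite eQ msizeM // -subn1 -addnBAC ?lt0n ?msize_poly_eq0 // leq_addl //.
  have := msize_dhomog (pihomogP mdeg (mdeg m1) M); rewrite -/Mj.
  move=> l1 l2; rewrite -ltnS; apply: leq_trans (leq_trans l2 l1).
  exact: msize_mdeg_lt.
have hM : M \is (mdeg (mlead M)).-homog.
  apply/dhomogP => m1 m1M; apply/eqP; rewrite eqn_leq !deg ?mlead_supp //.
exists (mdeg (mlead M)), M; split=> //.
rewrite lt0n; apply/negP => /eqP d0.
have := msize_dhomog hM; rewrite d0 => /msize1_polyC eM.
have := Jm _ Xx0; rewrite -/M eM mevalC => c0.
by move: M0; rewrite eM c0 mpolyC0 eqxx.
Qed.

(** * Polynomial functions on lines, discriminants *)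

Section LinePolynomial.
Variables (K : numFieldType) (W : lmodType K).

(* Polynomial functions on [W] enter only through their restrictions to lines. *)
Definition lpoly (g : W -> K) :=
  forall a b, exists p : {poly K}, forall t, g (a + t *: b) = p.[t].

Lemma lpolyC c : lpoly (fun=> c).
Proof. by move=> a b; exists c%:P => t; rewrite hornerC. Qed.

Lemma lpolyD g h : lpoly g -> lpoly h -> lpoly (fun w => g w + h w).
Proof.
move=> hg hh a b; have [p ep] := hg a b; have [q eq] := hh a b.
by exists (p + q) => t; rewrite hornerD ep eq.
Qed.

Lemma lpolyM g h : lpoly g -> lpoly h -> lpoly (fun w => g w * h w).
Proof.
move=> hg hh a b; have [p ep] := hg a b; have [q eq] := hh a b.
by exists (p * q) => t; rewrite hornerM ep eq.
Qed.

Lemma lpolyN g : lpoly g -> lpoly (fun w => - g w).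
Proof. by move=> hg a b; have [p ep] := hg a b; exists (- p) => t; rewrite hornerN ep. Qed.

Lemma lpolyB g h : lpoly g -> lpoly h -> lpoly (fun w => g w - h w).
Proof. by move=> hg /lpolyN; apply: lpolyD. Qed.

Lemma lpolyMn g n : lpoly g -> lpoly (fun w => g w *+ n).
Proof. by move=> hg a b; have [p ep] := hg a b; exists (p *+ n) => t; rewrite hornerMn ep. Qed.

Lemma lpolyX g n : lpoly g -> lpoly (fun w => g w ^+ n).
Proof. by move=> hg a b; have [p ep] := hg a b; exists (p ^+ n) => t; rewrite horner_exp ep. Qed.

Lemma lpoly_sum I (r : seq I) (P : pred I) (g : I -> W -> K) :
  (forall i, lpoly (g i)) -> lpoly (fun w => \sum_(i <- r | P i) g i w).
Proof.
move=> hg a b; have /choice [p ep] i := hg i a b.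
exists (\sum_(i <- r | P i) p i) => t; rewrite horner_sum.
by apply: eq_bigr => i _; apply: ep.
Qed.

Lemma lpoly_prod I (r : seq I) (P : pred I) (g : I -> W -> K) :
  (forall i, lpoly (g i)) -> lpoly (fun w => \prod_(i <- r | P i) g i w).
Proof.
move=> hg a b; have /choice [p ep] i := hg i a b.
exists (\prod_(i <- r | P i) p i) => t; rewrite horner_prod.
by apply: eq_bigr => i _; apply: ep.
Qed.

Lemma lpoly_linear (g : W -> K) : linear_for *%R g -> lpoly g.
Proof.
move=> lg a b; exists ((g b) *: 'X + (g a)%:P) => t.
by rewrite addrC lg hornerD hornerZ hornerX hornerC mulrC.
Qed.

Lemma lpoly_det n (A : W -> 'M[K]_n) :
  (forall i j, lpoly (fun w => A w i j)) -> lpoly (fun w => \det (A w)).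
Proof.
move=> hA; rewrite /determinant; apply: lpoly_sum => s.
by apply: lpolyM; [apply: lpolyC|apply: lpoly_prod => i; apply: hA].
Qed.

Lemma lpoly_meval n (H : {mpoly K[n]}) (g : W -> 'I_n -> K) :
  (forall i, lpoly (fun w => g w i)) -> lpoly (fun w => H.@[g w]).
Proof.
move=> hg; have -> : (fun w => H.@[g w]) =
    fun w => \sum_(m <- msupp H) H@_m * \prod_i g w i ^+ m i.
  by apply/funext => w; rewrite mevalE.
apply: lpoly_sum => m; apply: lpolyM; first exact: lpolyC.
by apply: lpoly_prod => i; apply/lpolyX/hg.
Qed.

(** On the line joining a point where g is nonzero to an arbitrary b, two polynomials in one
    variable have product 0 and the first is nonzero. *)
Lemma lpoly_mul_eq0 g h : lpoly g -> lpoly h -> (forall w, g w * h w = 0) ->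
  (forall w, g w = 0) \/ (forall w, h w = 0).
Proof.
move=> hg hh gh; have [//|/existsNP [a ga]] := EM (forall w, g w = 0); first by left.
right=> b; have [p ep] := hg a (b - a); have [q eq] := hh a (b - a).
have : p * q == 0 by apply/eqP/poly_eq0_eval => t; rewrite hornerM -ep -eq.
rewrite mulf_eq0 => /orP[] /eqP e.
  by case: ga; have := ep 0; rewrite scale0r addr0 e horner0.
by have := eq 1; rewrite scale1r addrC subrK e horner0.
Qed.

Lemma lpoly_dense D g w0 : lpoly D -> D w0 != 0 -> lpoly g ->
  (forall w, D w != 0 -> g w = 0) -> forall w, g w = 0.
Proof.
move=> hD D0 hg Dg; have [w||//] := lpoly_mul_eq0 hD hg.
  by have [->|/Dg ->] := eqVneq (D w) 0; rewrite ?mul0r ?mulr0.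
by move=> /(_ w0) /eqP; rewrite (negPf D0).
Qed.

Definition lpolyp (r : W -> {poly K}) := forall i, lpoly (fun w => (r w)`_i).

Lemma lpolypC g : lpoly g -> lpolyp (fun w => (g w)%:P).
Proof.
move=> hg [|i].
  by have -> : (fun w => ((g w)%:P)`_0) = g by apply/funext => w; rewrite coefC.
have -> : (fun w => ((g w)%:P)`_i.+1) = fun=> 0 by apply/funext => w; rewrite coefC.
exact: lpolyC.
Qed.

Lemma lpolyp_cst p : lpolyp (fun=> p).
Proof. by move=> i; apply: lpolyC. Qed.

Lemma lpolypD r s : lpolyp r -> lpolyp s -> lpolyp (fun w => r w + s w).
Proof.
move=> hr hs i; rewrite (_ : (fun w => _) = fun w => (r w)`_i + (s w)`_i).
  exact: lpolyD.
by apply/funext => w; rewrite coefD.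
Qed.

Lemma lpolypN r : lpolyp r -> lpolyp (fun w => - r w).
Proof.
move=> hr i; rewrite (_ : (fun w => _) = fun w => - (r w)`_i); first exact: lpolyN.
by apply/funext => w; rewrite coefN.
Qed.

Lemma lpolypM r s : lpolyp r -> lpolyp s -> lpolyp (fun w => r w * s w).
Proof.
move=> hr hs i; rewrite (_ : (fun w => _) =
    fun w => \sum_(j < i.+1) (r w)`_j * (s w)`_(i - j)).
  by apply: lpoly_sum => j; apply: lpolyM.
by apply/funext => w; rewrite coefM.
Qed.

Lemma lpolypX r n : lpolyp r -> lpolyp (fun w => r w ^+ n).
Proof.
move=> hr; elim: n => [|n IH]; first exact: (lpolyp_cst 1).
rewrite (_ : (fun w => _) = fun w => r w * r w ^+ n); first exact: lpolypM.
by apply/funext => w; rewrite exprS.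
Qed.

Lemma lpolypMn r n : lpolyp r -> lpolyp (fun w => r w *+ n).
Proof.
move=> hr i; rewrite (_ : (fun w => _) = fun w => (r w)`_i *+ n); first exact: lpolyMn.
by apply/funext => w; rewrite coefMn.
Qed.

End LinePolynomial.

Section GenericSeparable.
Variables (K : numClosedFieldType) (W : lmodType K) (m : nat).

Definition disc_row (r : {poly K}) (i : 'I_(m + m.+1)) : {poly K} :=
  match split i with inl i => 'X^i * r | inr i => 'X^i * r^`() end.

(* A Sylvester matrix of r and r' for the formal degree m + 1 of r. *)
Definition disc_mx (r : {poly K}) : 'M[K]_(m + m.+1) :=
  \matrix_(i, j) (disc_row r i)`_j.

Lemma size_disc_row (r : {poly K}) i : (size r <= m.+2)%N -> (size (disc_row r i) <= m + m.+1)%N.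
Proof.
move=> sr; have sd : (size r^`() <= m.+1)%N.
  have [->|r0] := eqVneq r 0; first by rewrite deriv0 size_poly0.
  by rewrite -ltnS (leq_trans (lt_size_deriv r0)).
rewrite /disc_row; case: split => j; rewrite mulrC.
  have [->|r0] := eqVneq r 0; first by rewrite mul0r size_poly0.
  by rewrite size_mulXn // (leq_trans (leq_add (leqnn j) sr)) // -addSnnS leq_add2r.
have [->|r0] := eqVneq r^`() 0; first by rewrite mul0r size_poly0.
by rewrite size_mulXn // leq_add // -ltnS.
Qed.

(** A common root x of r and r' puts the vector of powers of x into the kernel, even if the degree
    of r drops. *)
Lemma disc_separable (r : {poly K}) : (size r <= m.+2)%N -> \det (disc_mx r) != 0 -> separable_poly r.
Proof.
move=> sr; apply: contraNT; rewrite unlock /coprimep => /closed_rootP [x].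
rewrite root_gcd => /andP[/rootP rx /rootP rx'].
rewrite -det_tr; apply/det0P; exists (\row_j x ^+ j).
  apply/eqP => /rowP /(_ (Ordinal (ltn_addl m (ltn0Sn m)))).
  by rewrite !mxE expr0 => /eqP; rewrite oner_eq0.
apply/rowP => i; rewrite !mxE.
transitivity (disc_row r i).[x]; last first.
  by rewrite /disc_row; case: split => j; rewrite hornerM ?rx ?rx' mulr0.
rewrite (horner_coef_wide _ (size_disc_row i sr)).
by apply: eq_bigr => j _; rewrite !mxE mulrC.
Qed.

(** A vector killed by the matrix encodes u r + v r' = 0 with v of degree at most m. By coprimality
    r, of degree m + 1, divides v; so v = 0, and then u = 0. *)
Lemma separable_disc (r : {poly K}) : size r = m.+2 -> separable_poly r -> \det (disc_mx r) != 0.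
Proof.
move=> sr sepr; apply/negP => /det0P [x x0 /rowP xS].
pose u := \sum_(i < m) x 0 (lshift m.+1 i) *: 'X^i : {poly K}.
pose v := \sum_(i < m.+1) x 0 (rshift m i) *: 'X^i : {poly K}.
have suv : u * r + v * r^`() = \sum_i x 0 i *: disc_row r i.
  rewrite big_split_ord /= !mulr_suml; congr (_ + _); apply: eq_bigr => i _.
    by rewrite /disc_row (unsplitK (inl i)) scalerAl.
  by rewrite /disc_row (unsplitK (inr i)) scalerAl.
have e0 : u * r + v * r^`() = 0.
  rewrite suv; apply/polyP => j; rewrite coef0 coef_sum.
  have [jm|mj] := ltnP j (m + m.+1); last first.
    rewrite big1 // => i _; rewrite coefZ nth_default ?mulr0 //.
    by apply: leq_trans mj; apply: size_disc_row; rewrite sr.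
  have := xS (Ordinal jm); rewrite !mxE => h; rewrite -[RHS]h; apply: eq_bigr => i _.
  by rewrite coefZ !mxE.
have r0 : r != 0 by rewrite -size_poly_eq0 sr.
have v0 : v = 0.
  apply/eqP; apply: contraT => v0.
  have : r %| v * r^`().
    have -> : v * r^`() = - u * r by apply/eqP; rewrite mulNr -addr_eq0 addrC e0.
    exact: dvdp_mulIr.
  rewrite unlock in sepr; rewrite Gauss_dvdpl // => /(dvdp_leq v0); rewrite sr leqNgt ltnS => /negP [].
  apply: leq_trans (size_sum _ _ _) _; apply/bigmax_leqP => i _.
  by apply: leq_trans (size_scale_leq _ _) _; rewrite size_polyXn.
have u0 : u = 0.
  by apply/eqP; move/eqP: e0; rewrite v0 mul0r addr0 mulf_eq0 (negPf r0) orbF.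
case/eqP: x0; apply/rowP => i; rewrite mxE -(splitK i).
have co k (y : 'I_k -> K) (j : 'I_k) : (\sum_(i < k) y i *: 'X^i)`_j = y j :> K.
  rewrite coef_sum (bigD1 j) //= coefZ coefXn eqxx mulr1 big1 ?addr0 // => l lj.
  by rewrite coefZ coefXn eq_sym (negPf (lj : val l != val j)) mulr0.
case: (split i) => j /=; [rewrite -(co _ (fun i => x 0 (lshift m.+1 i)))|rewrite -(co _ (fun i => x 0 (rshift m i)))].
  by rewrite -/u u0 coef0.
by rewrite -/v v0 coef0.
Qed.

Lemma lpoly_disc (r : W -> {poly K}) : lpolyp r -> lpoly (fun w => \det (disc_mx (r w))).
Proof.
move=> hr; apply: lpoly_det => i j.
have -> : (fun w => disc_mx (r w) i j) = fun w => (disc_row (r w) i)`_j.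
  by apply/funext => w; rewrite mxE.
apply: (_ : lpolyp _); rewrite /disc_row; case: split => k.
  by apply: lpolypM => //; apply: lpolyp_cst.
apply: lpolypM => [|l]; first exact: lpolyp_cst.
have -> : (fun w => ((r w)^`())`_l) = fun w => (r w)`_l.+1 *+ l.+1.
  by apply/funext => w; rewrite coef_deriv.
exact: lpolyMn.
Qed.

End GenericSeparable.

(** * Elimination for eigenpoints and regularity *)

Section Resultant.
Variable S : comNzRingType.
Implicit Types a b e x y : S.

(* The resultant in y of a0 + a1 y + a2 y^2 + a3 y^3 and b0 + b1 y + b2 y^2. *)
Definition res32 a0 a1 a2 a3 b0 b1 b2 : S :=
  a0 ^+ 2 * b2 ^+ 3 - a0 * a1 * b1 * b2 ^+ 2 - a0 * a2 * b0 * b2 ^+ 2 *+ 2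
  + a0 * a2 * b1 ^+ 2 * b2 + a0 * a3 * b0 * b1 * b2 *+ 3 - a0 * a3 * b1 ^+ 3
  + a1 ^+ 2 * b0 * b2 ^+ 2 - a1 * a2 * b0 * b1 * b2 - a1 * a3 * b0 ^+ 2 * b2 *+ 2
  + a1 * a3 * b0 * b1 ^+ 2 + a2 ^+ 2 * b0 ^+ 2 * b2 - a2 * a3 * b0 ^+ 2 * b1
  + a3 ^+ 2 * b0 ^+ 3.

(** The witnesses are the Bezout multipliers of the resultant, of degree at most 1 and 2 in y. *)
Lemma res32_ideal y a0 a1 a2 a3 b0 b1 b2 : exists A B,
  res32 a0 a1 a2 a3 b0 b1 b2 =
  A * (a0 + a1 * y + a2 * y ^+ 2 + a3 * y ^+ 3) + B * (b0 + b1 * y + b2 * y ^+ 2).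
Proof.
exists ((- (a1 * b2 ^+ 3) + a2 * b1 * b2 ^+ 2 + a3 * b0 * b2 ^+ 2 - a3 * b1 ^+ 2 * b2) * y
  + (a0 * b2 ^+ 3 - a1 * b1 * b2 ^+ 2 - a2 * b0 * b2 ^+ 2 + a2 * b1 ^+ 2 * b2
     + a3 * b0 * b1 * b2 *+ 2 - a3 * b1 ^+ 3)).
exists ((a1 * a3 * b2 ^+ 2 - a2 * a3 * b1 * b2 - a3 ^+ 2 * b0 * b2 + a3 ^+ 2 * b1 ^+ 2) * y ^+ 2
  + (- (a0 * a3 * b2 ^+ 2) + a1 * a2 * b2 ^+ 2 - a2 ^+ 2 * b1 * b2 + a2 * a3 * b1 ^+ 2
     - a3 ^+ 2 * b0 * b1) * y
  + (- (a0 * a2 * b2 ^+ 2) + a0 * a3 * b1 * b2 + a1 ^+ 2 * b2 ^+ 2 - a1 * a2 * b1 * b2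
     - a1 * a3 * b0 * b2 *+ 2 + a1 * a3 * b1 ^+ 2 + a2 ^+ 2 * b0 * b2 - a2 * a3 * b0 * b1
     + a3 ^+ 2 * b0 ^+ 2)).
rewrite /res32; ring.
Qed.

Lemma res32_scale x a0 a1 a2 a3 b0 b1 b2 :
  res32 (x * a0) (x * a1) (x * a2) (x * a3) b0 b1 b2
  = x ^+ 2 * res32 a0 a1 a2 a3 b0 b1 b2.
Proof. rewrite /res32; ring. Qed.

(** Adding y times the second polynomial to the first does not change the values of the first at the
    roots of the second. *)
Lemma res32_shift e0 e1 e2 e3 b0 b1 b2 :
  res32 e0 (e1 + b0) (e2 + b1) (e3 + b2) b0 b1 b2 = res32 e0 e1 e2 e3 b0 b1 b2.
Proof. rewrite /res32; ring. Qed.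

End Resultant.

Section DegreeBound.
Variable K : idomainType.
Implicit Types p q : {poly K}.

Definition degle (k : nat) p := (size p <= k.+1)%N.

Lemma degleM k l p q : degle k p -> degle l q -> degle (k + l) (p * q).
Proof.
rewrite /degle => sp sq; apply: leq_trans (size_polyMleq _ _) _.
by rewrite -subn1 leq_subLR add1n -addnS -addSn leq_add.
Qed.

Lemma degle_exp k n p : degle k p -> degle (k * n) (p ^+ n).
Proof.
move=> sp; elim: n => [|n IH]; first by rewrite muln0 expr0 /degle size_poly1.
by rewrite mulnS exprS; apply: degleM.
Qed.

Lemma degleD k p q : degle k p -> degle k q -> degle k (p + q).
Proof.
by rewrite /degle => sp sq; apply: leq_trans (size_polyD _ _) _; rewrite geq_max sp.
Qed.

Lemma degleN k p : degle k p -> degle k (- p).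
Proof. by rewrite /degle size_polyN. Qed.

Lemma degleMn k n p : degle k p -> degle k (p *+ n).
Proof.
by move=> sp; elim: n => [|n IH]; rewrite ?mulr0n /degle ?size_poly0 // mulrS; apply: degleD.
Qed.

Lemma degleW k l p : degle k p -> (k <= l)%N -> degle l p.
Proof. by rewrite /degle => sp kl; apply: leq_trans sp _. Qed.

Lemma degleC c : degle 0 c%:P.
Proof. by rewrite /degle size_polyC leq_b1. Qed.

Lemma degleX : degle 1 'X.
Proof. by rewrite /degle size_polyX. Qed.

End DegreeBound.

Ltac term_degree := lazymatch goal with
  | |- is_true (degle _ (_ * _)) => eapply degleM; term_degree
  | |- is_true (degle _ (_ ^+ _)) => eapply degle_exp; term_degree
  | |- is_true (degle _ _%:P) => exact: degleC
  | |- is_true (degle _ 'X) => exact: degleX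
  | |- _ => eassumption
  end.

Ltac bound_degree := lazymatch goal with
  | |- is_true (degle _ (_ + _)) => eapply degleD; bound_degree
  | |- is_true (degle _ (- _)) => eapply degleN; bound_degree
  | |- is_true (degle _ (_ *+ _)) => eapply degleMn; bound_degree
  | |- _ => eapply degleW; [term_degree | by []]
  end.

(** Each term has two factors a_i and three factors b_j, with indices of sum 6; a coefficient of
    index i has degree at most 3 - i, and 15 - 6 = 9. *)
Lemma size_res32 (K : idomainType) (a0 a1 a2 a3 b0 b1 b2 : {poly K}) :
  degle 3 a0 -> degle 2 a1 -> degle 1 a2 -> degle 0 a3 ->
  degle 3 b0 -> degle 2 b1 -> degle 1 b2 -> degle 9 (res32 a0 a1 a2 a3 b0 b1 b2).
Proof. by move=> A0 A1 A2 A3 B0 B1 B2; rewrite /res32; bound_degree. Qed.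

Section Cubic.
Variable S : comNzRingType.
Implicit Types (c : nat -> S) (x y z : S).

Definition cubic c x y z : S :=
  c 0%N * x ^+ 3 + c 1%N * x ^+ 2 * y + c 2 * x ^+ 2 * z + c 3 * x * y ^+ 2
  + c 4 * x * z ^+ 2 + c 5 * y ^+ 3 + c 6 * y ^+ 2 * z + c 7 * y * z ^+ 2
  + c 8 * z ^+ 3 + c 9 * x * y * z.

Definition cubic_x c x y z : S :=
  c 0%N * x ^+ 2 *+ 3 + c 1%N * x * y *+ 2 + c 2 * x * z *+ 2 + c 3 * y ^+ 2
  + c 4 * z ^+ 2 + c 9 * y * z.

Definition cubic_y c x y z : S :=
  c 1%N * x ^+ 2 + c 3 * x * y *+ 2 + c 5 * y ^+ 2 *+ 3 + c 6 * y * z *+ 2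
  + c 7 * z ^+ 2 + c 9 * x * z.

Definition cubic_z c x y z : S :=
  c 2 * x ^+ 2 + c 4 * x * z *+ 2 + c 6 * y ^+ 2 + c 7 * y * z *+ 2
  + c 8 * z ^+ 2 *+ 3 + c 9 * x * y.

(* The coefficients of the powers of y in y f_z - f_y and x f_z - f_x at z = 1. *)
Definition elim c x : S :=
  res32 (- (c 1%N * x ^+ 2 + c 7 + c 9 * x))
    (c 2 * x ^+ 2 + c 4 * x *+ 2 + c 8 *+ 3 - c 3 * x *+ 2 - c 6 *+ 2)
    (c 7 *+ 2 + c 9 * x - c 5 *+ 3) (c 6)
    (c 2 * x ^+ 3 + c 4 * x ^+ 2 *+ 2 + c 8 * x *+ 3 - c 0%N * x ^+ 2 *+ 3 - c 2 * x *+ 2 - c 4)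
    (c 7 * x *+ 2 + c 9 * x ^+ 2 - c 1%N * x *+ 2 - c 9)
    (c 6 * x - c 3).

Lemma elim_ideal c x y : exists A B,
  elim c x = A * (y * cubic_z c x y 1 - cubic_y c x y 1)
           + B * (x * cubic_z c x y 1 - cubic_x c x y 1).
Proof.
have [A [B e]] := res32_ideal y (- (c 1%N * x ^+ 2 + c 7 + c 9 * x))
    (c 2 * x ^+ 2 + c 4 * x *+ 2 + c 8 *+ 3 - c 3 * x *+ 2 - c 6 *+ 2)
    (c 7 *+ 2 + c 9 * x - c 5 *+ 3) (c 6)
    (c 2 * x ^+ 3 + c 4 * x ^+ 2 *+ 2 + c 8 * x *+ 3 - c 0%N * x ^+ 2 *+ 3 - c 2 * x *+ 2 - c 4)
    (c 7 * x *+ 2 + c 9 * x ^+ 2 - c 1%N * x *+ 2 - c 9)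
    (c 6 * x - c 3).
exists A, B; rewrite /elim e /cubic_x /cubic_y /cubic_z; ring.
Qed.

(* By x (y f_z - z f_y) = y (x f_z - z f_x) + z (y f_x - x f_y), the product of x with
   the first polynomial of [elim] may be replaced by y f_x - x f_y in the resultant,
   which is of the same total degree 3; hence elim c x has degree at most 9 - 2. *)
Lemma elim_sqr c x : x ^+ 2 * elim c x =
  res32 (- (c 1%N * x ^+ 3 + c 7 * x + c 9 * x ^+ 2))
    (c 0%N * x ^+ 2 *+ 3 + c 2 * x *+ 2 + c 4 - c 3 * x ^+ 2 *+ 2 - c 6 * x *+ 2)
    (c 1%N * x *+ 2 + c 9 - c 5 * x *+ 3) (c 3)
    (c 2 * x ^+ 3 + c 4 * x ^+ 2 *+ 2 + c 8 * x *+ 3 - c 0%N * x ^+ 2 *+ 3 - c 2 * x *+ 2 - c 4)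
    (c 7 * x *+ 2 + c 9 * x ^+ 2 - c 1%N * x *+ 2 - c 9)
    (c 6 * x - c 3).
Proof.
rewrite -[RHS]res32_shift /elim -res32_scale.
rewrite /res32; ring.
Qed.

End Cubic.

Definition elimp (K : idomainType) (c : nat -> K) : {poly K} :=
  elim (fun n => (c n)%:P) 'X.

(** The degree 7 is the number of points of a regular eigenscheme. The bound has to be sharp: for a
    larger formal degree the last column of [disc_mx] would be zero. *)
Lemma size_elimp (K : idomainType) (c : nat -> K) : (size (elimp c) <= 8)%N.
Proof.
have : degle 9 (elimp c * 'X^2).
  by rewrite mulrC /elimp elim_sqr; apply: size_res32; cbv beta; bound_degree.
have [->|e0] := eqVneq (elimp c) 0; first by rewrite size_poly0.
by rewrite /degle size_mulXn // add2n !ltnS.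
Qed.

Ltac line_polyp := lazymatch goal with
  | |- lpolyp (fun w => @?r w + @?s w) => apply: (@lpolypD _ _ r s); line_polyp
  | |- lpolyp (fun w => - @?r w) => apply: (@lpolypN _ _ r); line_polyp
  | |- lpolyp (fun w => @?r w *+ ?n) => apply: (@lpolypMn _ _ r n); line_polyp
  | |- lpolyp (fun w => @?r w * @?s w) => apply: (@lpolypM _ _ r s); line_polyp
  | |- lpolyp (fun w => @?r w ^+ ?n) => apply: (@lpolypX _ _ r n); line_polyp
  | |- lpolyp (fun w => (@?g w)%:P) => apply: (@lpolypC _ _ g)
  | |- lpolyp (fun w => ?p) => exact: (@lpolyp_cst _ _ p)
  end.

Lemma lpolyp_elimp (K : numFieldType) (W : lmodType K) (c : W -> nat -> K) :
  (forall n, lpoly (fun w => c w n)) -> lpolyp (fun w => elimp (c w)).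
Proof. by move=> hc; rewrite /elimp /elim /res32; line_polyp. Qed.

(** There are as many distinct roots as the degree allows. They are given as rationals so that
    distinctness is decided by computation. *)
Lemma separable_of_roots (K : fieldType) (p : {poly K}) (rs : seq rat)
    (h : {rmorphism rat -> K}) :
  p != 0 -> (size p <= (size rs).+1)%N -> uniq rs -> all (root p) [seq h q | q <- rs] ->
  size p = (size rs).+1 /\ separable_poly p.
Proof.
move=> p0 sp urs rp; have uh : uniq [seq h q | q <- rs].
  by rewrite map_inj_uniq //; apply: fmorph_inj.
have {}sp : size p = (size rs).+1.
  by apply/eqP; rewrite eqn_leq sp -(size_map h) max_poly_roots.
split=> //.
have := all_roots_prod_XsubC _ rp _; rewrite size_map uniq_rootsE => /(_ sp uh) ->.
rewrite unlock derivZ coprimepZl ?coprimepZr ?lead_coef_eq0 //.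
by have := separable_prod_XsubC [seq h q | q <- rs]; rewrite unlock uh.
Qed.

Section Sample.
Variable K : numFieldType.

(* x^3 + y^3 + z^3 + 6xyz + 41(x^2y + y^2z + z^2x) + 5(xy^2 + yz^2 + zx^2) has
   the eigenpoints (1:1:1), (1:-2:-1), (1:-5:4) and their cyclic shifts; the last
   three are on the line x + y + z = 0. *)
Definition sample (n : nat) : K :=
  nth 0 [:: 1; 41%:R; 5%:R; 5%:R; 41%:R; 1; 41%:R; 5%:R; 1; 6%:R] n.

(** The sample with x and y exchanged. By its cyclic symmetry, every renaming of the variables gives
    one of these two cubics. *)
Definition sample' (n : nat) : K :=
  nth 0 [:: 1; 5%:R; 41%:R; 41%:R; 5%:R; 1; 5%:R; 41%:R; 1; 6%:R] n.

(** The roots are the values of x/z at the seven eigenpoints. *)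
Lemma elimp_sample : elimp sample =
  (36 * 7 ^+ 6)%:P * (('X - 1%:P) * ('X + 1%:P) * ('X + 2%:P) * (2%:P * 'X - 1%:P)
    * (4%:P * 'X - 1%:P) * ('X + 5%:P) * (5%:P * 'X + 4%:P)).
Proof.
rewrite /elimp /elim /res32 /sample /= !(polyCM, rmorphXn, polyC_natr) /=; ring.
Qed.

Lemma elimp_sample' : elimp sample' =
  (36 * 7 ^+ 6)%:P * (('X - 1%:P) * ('X + 1%:P) * (2%:P * 'X + 1%:P) * ('X - 2%:P)
    * ('X - 4%:P) * (5%:P * 'X + 1%:P) * (4%:P * 'X + 5%:P)).
Proof.
rewrite /elimp /elim /res32 /sample' /= !(polyCM, rmorphXn, polyC_natr) /=; ring.
Qed.

Lemma separable_sample : size (elimp sample) = 8 /\ separable_poly (elimp sample).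
Proof.
apply: (separable_of_roots (rs := [:: 1; -1; -2; 1 / 2; 1 / 4; -5; - (4 / 5)]) (h := ratr)).
- apply/eqP => /(congr1 (horner^~ 0)); rewrite elimp_sample !(hornerM, hornerD, hornerN, hornerC, hornerX) => /eqP.
  by rewrite !mulr0 !sub0r !add0r !(mulf_eq0, expf_eq0, oppr_eq0, oner_eq0, pnatr_eq0).
- exact: size_elimp.
- by [].
rewrite /= !(rmorphN, fmorph_div, ratr_nat) /root elimp_sample !(hornerM, hornerD, hornerN, hornerC, hornerX).
by do ![apply/andP; split] => //; apply/eqP; field.
Qed.

Lemma separable_sample' : size (elimp sample') = 8 /\ separable_poly (elimp sample').
Proof.
apply: (separable_of_roots (rs := [:: 1; -1; - (1 / 2); 2; 4; - (1 / 5); - (5 / 4)]) (h := ratr)).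
- apply/eqP => /(congr1 (horner^~ 0)); rewrite elimp_sample' !(hornerM, hornerD, hornerN, hornerC, hornerX) => /eqP.
  by rewrite !mulr0 !sub0r !add0r !(mulf_eq0, expf_eq0, oppr_eq0, oner_eq0, pnatr_eq0).
- exact: size_elimp.
- by [].
rewrite /= !(rmorphN, fmorph_div, ratr_nat) /root elimp_sample' !(hornerM, hornerD, hornerN, hornerC, hornerX).
by do ![apply/andP; split] => //; apply/eqP; field.
Qed.

End Sample.

(** * Reducedness from a separable polynomial in each variable *)

Section Radical.
Variable K : numClosedFieldType.

Definition at_var (i : 'I_2) (p : {poly K}) : {mpoly K[2]} :=
  (map_poly (@mpolyC 2 K) p).['X_i].

Lemma at_varM i p q : at_var i (p * q) = at_var i p * at_var i q.
Proof. by rewrite /at_var rmorphM hornerM. Qed.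

Lemma at_varD i p q : at_var i (p + q) = at_var i p + at_var i q.
Proof. by rewrite /at_var rmorphD hornerD. Qed.

Lemma at_varC i c : at_var i c%:P = c%:MP.
Proof. by rewrite /at_var map_polyC hornerC. Qed.

Lemma at_varX i : at_var i 'X = 'X_i.
Proof. by rewrite /at_var map_polyX hornerX. Qed.

Definition curry2 : {mpoly K[2]} -> {poly {poly K}} :=
  mmap (polyC \o polyC) (fun i => if i == ord0 then 'X%:P else 'X).

Definition uncurry2 (P : {poly {poly K}}) : {mpoly K[2]} :=
  (map_poly (at_var ord0) P).['X_ord_max].

Lemma at_var_additive i : zmod_morphism (at_var i).
Proof. by move=> p q; rewrite /at_var rmorphB hornerD hornerN. Qed.

Lemma at_var_multiplicative i : monoid_morphism (at_var i).
Proof. by split=> [|p q]; [rewrite /at_var rmorph1 hornerC|exact: at_varM]. Qed.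

HB.instance Definition _ i :=
  GRing.isZmodMorphism.Build {poly K} {mpoly K[2]} (at_var i) (at_var_additive i).
HB.instance Definition _ i :=
  GRing.isMonoidMorphism.Build {poly K} {mpoly K[2]} (at_var i) (at_var_multiplicative i).

Lemma uncurry2M P Q : uncurry2 (P * Q) = uncurry2 P * uncurry2 Q.
Proof. by rewrite /uncurry2 rmorphM hornerM. Qed.

Lemma uncurry2D P Q : uncurry2 (P + Q) = uncurry2 P + uncurry2 Q.
Proof. by rewrite /uncurry2 rmorphD hornerD. Qed.

Lemma uncurry2C p : uncurry2 p%:P = at_var ord0 p.
Proof. by rewrite /uncurry2 map_polyC hornerC. Qed.

Lemma uncurry2_map p : uncurry2 (map_poly polyC p) = at_var ord_max p.
Proof.
rewrite /uncurry2 [RHS]/at_var -map_poly_comp; congr (_.[_]).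
by apply: eq_map_poly => c; rewrite /= at_varC.
Qed.

Lemma curry2K : cancel curry2 uncurry2.
Proof.
move=> p; rewrite /curry2 /mmap.
transitivity (\sum_(m <- msupp p) p@_m *: 'X_[m]); last by rewrite -mpolyE.
rewrite (big_morph _ uncurry2D (id1 := 0)); last by rewrite /uncurry2 rmorph0 horner0.
apply: eq_bigr => m _; rewrite uncurry2M /= uncurry2C at_varC -mul_mpolyC; congr (_ * _).
rewrite /mmap1 (mpolyXE_id _ m) !big_ord_recl !big_ord0 !mulr1 uncurry2M.
have X k P : uncurry2 (P ^+ k) = uncurry2 P ^+ k.
  elim: k => [|k IH]; last by rewrite !exprS uncurry2M IH.
  by rewrite !expr0 /uncurry2 rmorph1 hornerC.
rewrite !X uncurry2C at_varX /uncurry2 map_polyX hornerX.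
by congr (_ * 'X_ _ ^+ _); apply/val_inj.
Qed.

Lemma horner_curry2 p a b : (curry2 p).[b%:P].[a] =
  p.@[fun i => if i == ord0 then a else b].
Proof.
rewrite /curry2 /mmap mevalE !horner_sum; apply: eq_bigr => m _.
rewrite !hornerM /= !hornerC; congr (_ * _).
rewrite /mmap1 !horner_prod; apply: eq_bigr => i _.
by rewrite !horner_exp; case: (i == ord0); rewrite ?hornerC ?hornerX ?hornerC.
Qed.

(** Divide by the monic polynomial of B in the second variable. At each a in A the remainder has
    degree below |B| and all of B as roots, hence is zero; so its coefficients are divisible by the
    polynomial of A. *)
Lemma grid_vanish (A B : seq K) (p : {mpoly K[2]}) : uniq A -> uniq B ->
  (forall a b, a \in A -> b \in B -> p.@[fun i => if i == ord0 then a else b] = 0) ->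
  exists s t, p = s * at_var ord0 (\prod_(a <- A) ('X - a%:P))
                + t * at_var ord_max (\prod_(b <- B) ('X - b%:P)).
Proof.
move=> uA uB hp; set PA := \prod_(a <- A) _; set PB := \prod_(b <- B) _.
have mB : map_poly polyC PB \is monic by rewrite map_monic monic_prod_XsubC.
have := Pdiv.RingMonic.rdivp_eq mB (curry2 p).
set Q := Pdiv.Ring.rdivp _ _; set R := Pdiv.Ring.rmodp _ _ => e.
have sR : (size R <= size B)%N.
  rewrite -ltnS -(size_prod_XsubC B id) -/PB -(size_map_polyC PB).
  by apply: Pdiv.Ring.ltn_rmodpN0; apply: monic_neq0.
have R0 a : a \in A -> map_poly (horner_eval a) R = 0.
  move=> aA; apply/eqP; apply: contraT => r0.
  have sr : (size (map_poly (horner_eval a) R) <= size B)%N by apply: leq_trans (size_poly _ _) sR.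
  have := max_poly_roots r0 _ uB; rewrite ltnNge sr => /(_ _)/negP; case => //.
  apply/allP => b bB; rewrite /root.
  have -> : (map_poly (horner_eval a) R).[b] = R.[b%:P].[a].
    by rewrite -[b in LHS](hornerC b a) -/(horner_eval a b%:P) horner_map.
  have := hp a b aA bB; rewrite -horner_curry2 e !hornerD !hornerM.
  have -> : (map_poly polyC PB).[b%:P] = 0.
    by rewrite horner_map /=; have /rootP -> : root PB b; rewrite ?root_prod_XsubC ?polyC0.
  by rewrite horner0 mulr0 add0r => ->.
have [R' eR] : exists R', R = PA%:P * R'.
  exists (\poly_(i < size R) (R`_i %/ PA)); apply/polyP => i.
  rewrite coefCM coef_poly; case: ltnP => [_|si]; last by rewrite mulr0 nth_default.
  rewrite mulrC divpK //; apply: uniq_roots_dvdp; last by rewrite uniq_rootsE.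
  apply/allP => a aA; rewrite /root; have := congr1 (fun r : {poly K} => r`_i) (R0 a aA).
  by rewrite coef_map coef0 => /= /eqP.
exists (uncurry2 R'), (uncurry2 Q).
by rewrite -[LHS]curry2K e eR uncurry2D !uncurry2M uncurry2C uncurry2_map addrC [X in X + _]mulrC.
Qed.

(* Modulo the two polynomials every p satisfies p w(p) = 0, where w has the
   nonzero values of p on the grid as roots, hence w(0) <> 0. *)
Lemma radical_of_separable (J : {mpoly K[2]} -> Prop) (p0 p1 : {poly K}) :
  (forall p q, J p -> J q -> J (p + q)) -> (forall p q, J q -> J (p * q)) ->
  p0 != 0 -> p1 != 0 -> separable_poly p0 -> separable_poly p1 ->
  J (at_var ord0 p0) -> J (at_var ord_max p1) ->
  forall p e, J (p ^+ e) -> J p.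
Proof.
move=> JD JM p00 p10 sp0 sp1 J0 J1.
have monicJ i (p : {poly K}) : p != 0 -> separable_poly p -> J (at_var i p) ->
    exists2 A, uniq A & J (at_var i (\prod_(a <- A) ('X - a%:P))).
  move=> pn0 sp Jp; have [A eA] := closed_field_poly_normal p; exists A.
    have := sp; rewrite eA unlock derivZ coprimepZl ?coprimepZr ?lead_coef_eq0 // => c.
    by rewrite -separable_prod_XsubC unlock.
  have := JM (lead_coef p)^-1%:MP _ Jp; rewrite {2}eA -mul_polyC at_varM at_varC mulrA.
  by rewrite -mpolyCM mulVf ?lead_coef_eq0 // mpolyC1 mul1r.
have [A uA JA] := monicJ _ _ p00 sp0 J0; have [B uB JB] := monicJ _ _ p10 sp1 J1.
move=> p.
pose V := [seq v <- [seq p.@[fun i => if i == ord0 then x.1 else x.2] | x <- [seq (a, b) | a <- A, b <- B]] | v != 0].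
have Jw : J (p * \prod_(v <- V) (p - v%:MP)).
  have [|s [t ->]] := @grid_vanish A B (p * \prod_(v <- V) (p - v%:MP)) uA uB.
    move=> a b aA bB; set x := fun i => _; rewrite mevalM rmorph_prod /=.
    have [->|px] := eqVneq p.@[x] 0; first by rewrite mul0r.
    have xV : p.@[x] \in V.
      by rewrite mem_filter px; apply/mapP; exists (a, b) => //; apply/allpairsP; exists (a, b).
    by rewrite (big_rem _ xV) /= mevalB mevalC subrr mul0r mulr0.
  by apply: JD; apply: JM.
have [c c0 [w ew]] : exists2 c, c != 0 & exists w, \prod_(v <- V) (p - v%:MP) = c%:MP + p * w.
  have : all (fun v => v != 0) V by apply/allP => v; rewrite mem_filter => /andP[].
  elim: (V) => [|v r IH] /=; first by exists 1; rewrite ?oner_eq0 //; exists 0; rewrite big_nil mulr0 addr0.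
  move=> /andP[v0 /IH [c c0 [w ew]]]; exists (- v * c); first by rewrite mulf_neq0 ?oppr_eq0.
  exists (c%:MP + p * w - v%:MP * w); rewrite big_cons ew mpolyCM mpolyCN; ring.
elim=> [|[|e] IH]; first by move=> J1'; rewrite -[p]mulr1; apply: JM.
  by rewrite expr1.
(* The constant term [c] of the product over V is a unit, which lowers the exponent by one. *)
move=> Je; apply: IH; have J2 : J (c%:MP * p ^+ e.+1).
  have -> : c%:MP * p ^+ e.+1 = p ^+ e * (p * \prod_(v <- V) (p - v%:MP)) + (- w) * p ^+ e.+2.
    by rewrite ew !exprS; ring.
  by apply: JD; apply: JM.
have := JM (c^-1)%:MP _ J2.
by rewrite mulrA -mpolyCM mulVf // mpolyC1 mul1r.
Qed.

End Radical.

Notation o0 := (@Ordinal 3 0 isT).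
Notation o1 := (@Ordinal 3 1 isT).
Notation o2 := (@Ordinal 3 2 isT).

Lemma ord3P (P : 'I_3 -> Prop) : P o0 -> P o1 -> P o2 -> forall i, P i.
Proof.
by move=> P0 P1 P2 [[|[|[|//]]] h]; [move: P0|move: P1|move: P2]; congr P; apply: val_inj.
Qed.

Lemma ord2P (P : 'I_2 -> Prop) : P ord0 -> P ord_max -> forall i, P i.
Proof. by move=> P0 P1 [[|[|//]] h]; [move: P0|move: P1]; congr P; apply: val_inj. Qed.

Definition grad3 (S : comNzRingType) (c : nat -> S) (x : 'I_3 -> S) (i : 'I_3) : S :=
  nth 0 [:: cubic_x c (x o0) (x o1) (x o2); cubic_y c (x o0) (x o1) (x o2);
            cubic_z c (x o0) (x o1) (x o2)] i.

Section RMorphism.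
Variables (S T : comNzRingType) (h : {rmorphism S -> T}).

Lemma rmorph_res32 a0 a1 a2 a3 b0 b1 b2 : h (res32 a0 a1 a2 a3 b0 b1 b2) =
  res32 (h a0) (h a1) (h a2) (h a3) (h b0) (h b1) (h b2).
Proof. by rewrite /res32 !(rmorphD, rmorphN, rmorphM, rmorphXn, rmorphMn). Qed.

Lemma rmorph_elim c x : h (elim c x) = elim (h \o c) (h x).
Proof. by rewrite /elim rmorph_res32 !(rmorphD, rmorphN, rmorphM, rmorphXn, rmorphMn). Qed.

Lemma rmorph_grad3 c x i : h (grad3 c x i) = grad3 (h \o c) (h \o x) i.
Proof.
by move: i; apply: ord3P; rewrite /grad3 /= /cubic_x /cubic_y /cubic_z
  !(rmorphD, rmorphN, rmorphM, rmorphXn, rmorphMn).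
Qed.

End RMorphism.

Definition cubic_exponents : seq (seq nat) :=
  [:: [:: 3; 0; 0]; [:: 2; 1; 0]; [:: 2; 0; 1]; [:: 1; 2; 0]; [:: 1; 0; 2];
      [:: 0; 3; 0]; [:: 0; 2; 1]; [:: 0; 1; 2]; [:: 0; 0; 3]; [:: 1; 1; 1]]%N.

(* The coefficients of a cubic written in the variables x_i, x_j, x_k in place of
   x_0, x_1, x_2. *)
Definition perm_coef (T : Type) (i j k : nat) (c : nat -> T) (n : nat) : T :=
  let e := nth [::] cubic_exponents n in
  c (index [seq nth 0%N e (index l [:: i; j; k]) | l <- [:: 0; 1; 2]%N] cubic_exponents).

Definition cub (K : comNzRingType) (c : nat -> K) : {mpoly K[3]} :=
  cubic (fun n => (c n)%:MP) 'X_o0 'X_o1 'X_o2.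

Section Cub.
Variable K : comNzRingType.

Lemma mderivXU n (i j : 'I_n) : ('X_j : {mpoly K[n]})^`M(i) = (i == j)%:R.
Proof.
rewrite mderivX mnm1E eq_sym; case: eqP => [->|_]; last by rewrite scale0r.
rewrite scale1r (_ : (U_(j) - U_(j))%MM = 0%MM) ?mpolyX0 //.
by apply/mnmP => k; rewrite mnmBE subnn mnm0E.
Qed.

Lemma mderiv_cub (c : nat -> K) i :
  (cub c)^`M(i) = grad3 (fun n => (c n)%:MP) (fun j => 'X_j) i.
Proof.
have dX a b : ('X_b : {mpoly K[3]})^`M(a) = (a == b)%:R by apply: mderivXU.
move: i; apply: ord3P; rewrite /cub /cubic !exprS !expr0 !mulr1 !(mderivD, mderivM, mderivC, dX) /=;
  rewrite /grad3 /= /cubic_x /cubic_y /cubic_z; ring.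
Qed.

End Cub.

Definition chart_var (K : comNzRingType) (k j : 'I_3) : {mpoly K[2]} :=
  if unlift k j is Some l then 'X_l else 1.

Lemma det_mx2 (K : comNzRingType) (A : 'M[K]_2) :
  \det A = A ord0 ord0 * A ord_max ord_max - A ord0 ord_max * A ord_max ord0.
Proof.
rewrite (expand_det_row _ ord0) !big_ord_recl big_ord0 addr0 /cofactor !det_mx11 !mxE.
have e1 : lift ord0 ord0 = ord_max :> 'I_2 by apply: val_inj.
have e2 : lift (lift ord0 ord0) ord0 = ord0 :> 'I_2 by apply: val_inj.
by rewrite e2 e1 /= addn0 expr0 mul1r expr1 mulN1r mulrN.
Qed.

Lemma eigen_minorE (K : fieldType) (f : {mpoly K[3]}) m :
  eigen_minor f m = 'X_(lift m ord0) * f^`M(lift m ord_max)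
                  - 'X_(lift m ord_max) * f^`M(lift m ord0).
Proof. by rewrite /eigen_minor det_mx2 /eigen_mx !mxE. Qed.

Lemma dehomog_minor (K : fieldType) k (c : nat -> K) m :
  let G := grad3 (fun n => (c n)%:MP) (chart_var K k) in
  dehomog k (eigen_minor (cub c) m) =
  chart_var K k (lift m ord0) * G (lift m ord_max) - chart_var K k (lift m ord_max) * G (lift m ord0).
Proof.
have dX j : dehomog k 'X_j = chart_var K k j.
  by rewrite /dehomog /chart_var comp_mpolyXU -tnth_nth tnth_mktuple.
have dG i : dehomog k (grad3 (fun n => (c n)%:MP) (fun j => 'X_j) i) =
    grad3 (fun n => (c n)%:MP) (chart_var K k) i.
  pose lq := [tuple (if unlift k j is Some l then 'X_l else 1) | j < 3] : 3.-tuple {mpoly K[2]}.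
  have e := rmorph_grad3 (comp_mpoly lq) (fun n => (c n)%:MP) (fun j => 'X_j) i.
  transitivity (grad3 (comp_mpoly lq \o (fun n => (c n)%:MP)) (comp_mpoly lq \o (fun j => 'X_j)) i).
    exact: e.
  have -> : comp_mpoly lq \o (fun n => (c n)%:MP) = fun n => (c n)%:MP.
    by apply/funext => n; apply: comp_mpolyC.
  by have -> : comp_mpoly lq \o (fun j => 'X_j) = chart_var K k by apply/funext => j; apply: dX.
have dB p q : dehomog k (p - q : {mpoly K[3]}) = dehomog k p - dehomog k q by apply: rmorphB.
have dM p q : dehomog k (p * q : {mpoly K[3]}) = dehomog k p * dehomog k q by apply: rmorphM.
by rewrite /= eigen_minorE !mderiv_cub dB !dM !dX !dG.
Qed.

Lemma at_var_elimp (K : numClosedFieldType) (l : 'I_2) (c : nat -> K) :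
  at_var l (elimp c) = elim (fun n => (c n)%:MP) 'X_l.
Proof.
have h : at_var l \o (fun n => (c n)%:P) = fun n => (c n)%:MP.
  by apply/funext => n; apply: at_varC.
rewrite -h -at_varX; exact: (rmorph_elim (at_var l)).
Qed.

Lemma lift3E : ((lift o0 ord0 = o1) * (lift o0 ord_max = o2) * (lift o1 ord0 = o0)
  * (lift o1 ord_max = o2) * (lift o2 ord0 = o0) * (lift o2 ord_max = o1))%type.
Proof. by do !split; apply: val_inj. Qed.

Lemma rev_ord2E : ((rev_ord ord0 = ord_max :> 'I_2) * (rev_ord ord_max = ord0 :> 'I_2))%type.
Proof. by split; apply: val_inj. Qed.

Lemma chart_varE (K : comNzRingType) :
  ((chart_var K o0 o0 = 1) * (chart_var K o0 o1 = 'X_ord0) * (chart_var K o0 o2 = 'X_ord_max)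
   * (chart_var K o1 o0 = 'X_ord0) * (chart_var K o1 o1 = 1) * (chart_var K o1 o2 = 'X_ord_max)
   * (chart_var K o2 o0 = 'X_ord0) * (chart_var K o2 o1 = 'X_ord_max) * (chart_var K o2 o2 = 1))%type.
Proof.
have cv k l : chart_var K k (lift k l) = 'X_l by rewrite /chart_var liftK.
have cvk k : chart_var K k k = 1 by rewrite /chart_var unlift_none.
by do !split; first [exact: cvk | by rewrite -[RHS](cv o0) lift3E
  | by rewrite -[RHS](cv o1) lift3E | by rewrite -[RHS](cv o2) lift3E].
Qed.

(** The renaming gives x_k the role of z = 1 and the l-th affine coordinate that of x. The two
    polynomials from which [elim] removes y are then, up to sign, dehomogenised minors. *)
Lemma chart_elim (K : numClosedFieldType) (k : 'I_3) (l : 'I_2) (c : nat -> K) :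
  ideal_gen (fun j => dehomog k (eigen_minor (cub c) j))
    (at_var l (elimp (perm_coef (lift k l) (lift k (rev_ord l)) k c))).
Proof.
set g := fun j => _; rewrite at_var_elimp.
have [A [B ->]] := elim_ideal (fun n => (perm_coef (lift k l) (lift k (rev_ord l)) k c n)%:MP)
  ('X_l : {mpoly K[2]}) 'X_(rev_ord l).
set P := _ - _; set Q := _ - _.
have gen i j a b : P = a * g i -> Q = b * g j -> ideal_gen g (A * P + B * Q).
  move=> -> ->; exists (fun m => A * a * (m == i)%:R + B * b * (m == j)%:R).
  under eq_bigr do rewrite mulrDl.
  rewrite big_split /= (bigD1 i) //= eqxx big1 => [|m /negPf ->]; last by rewrite mulr0 mul0r.
  rewrite (bigD1 j) //= eqxx big1 => [|m /negPf ->]; last by rewrite mulr0 mul0r.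
  by move: (g i) (g j) => u v; rewrite !addr0 !mulr1 !mulrA.
pose G := grad3 (fun n => (c n)%:MP) (chart_var K k).
have gE m : g m = chart_var K k (lift m ord0) * G (lift m ord_max)
                - chart_var K k (lift m ord_max) * G (lift m ord0).
  exact: dehomog_minor.
move: gen; rewrite {}/P {}/Q; clearbody g => gen.
(* The minors keep their columns in increasing order, the renaming need not; hence signs that depend
   on k and l. *)
have [s [s' [eP eQ]]] : exists s s',
   'X_(rev_ord l) * cubic_z (fun n => (perm_coef (lift k l) (lift k (rev_ord l)) k c n)%:MP) 'X_l 'X_(rev_ord l) 1
   - cubic_y (fun n => (perm_coef (lift k l) (lift k (rev_ord l)) k c n)%:MP) 'X_l 'X_(rev_ord l) 1 = s * g (lift k l)
 /\ 'X_l * cubic_z (fun n => (perm_coef (lift k l) (lift k (rev_ord l)) k c n)%:MP) 'X_l 'X_(rev_ord l) 1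
   - cubic_x (fun n => (perm_coef (lift k l) (lift k (rev_ord l)) k c n)%:MP) 'X_l 'X_(rev_ord l) 1 = s' * g (lift k (rev_ord l)).
  rewrite !gE /G {gen gE G}; move: l; apply: ord2P; move: k; apply: ord3P;
    rewrite !(rev_ord2E, lift3E, chart_varE) /grad3 /= !chart_varE /perm_coef /cubic_x /cubic_y /cubic_z /=;
  move: ('X_ord0 : {mpoly K[2]}) ('X_ord_max : {mpoly K[2]}) => x y;
  move: (c 0%N)%:MP_[2] (c 1%N)%:MP_[2] (c 2)%:MP_[2] (c 3)%:MP_[2] (c 4)%:MP_[2]
    (c 5)%:MP_[2] (c 6)%:MP_[2] (c 7)%:MP_[2] (c 8)%:MP_[2] (c 9)%:MP_[2]
    => c0 c1 c2 c3 c4 c5 c6 c7 c8 c9;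
  by first [exists 1, 1; split; ring | exists 1, (-1); split; ring
           | exists (-1), 1; split; ring | exists (-1), (-1); split; ring].
exact: gen eP eQ.
Qed.

(** * Lines, closed sets and points of a projective space *)

Section Closed.
Variables (K : fieldType) (V : vectType K).

Lemma pline_neq0 (p : proj V) : exists2 v, v \in pline p & v != 0.
Proof.
have p0 : pline p != 0%VS by rewrite -dimv_eq0 (eqP (valP p)).
by exists (vpick (pline p)); rewrite ?memv_pick ?vpick0.
Qed.

Lemma pline_line (p : proj V) v : v \in pline p -> v != 0 -> pline p = <[v]>%VS.
Proof.
move=> vp v0; apply/esym/eqP.
by rewrite eqEdim -memvE vp dim_vline v0 (eqP (valP p)).
Qed.

Lemma pline_inj (p q : proj V) : pline p = pline q -> p = q.
Proof. exact: val_inj. Qed.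

Lemma zclosedI (A B : set (proj V)) : zclosed A -> zclosed B -> zclosed (A `&` B).
Proof.
move=> [S [hS ->]] [T [hT ->]]; exists (S `|` T); split; first by move=> F [/hS|/hT].
apply/seteqP; split=> p /=; first by move=> [h1 h2] F [/h1|/h2].
by move=> h; split=> F FS; apply: h; [left|right].
Qed.

(** Finite unions of hyperplanes: the coverings of the eigenpoints and the closedness of a point
    rest on these. *)
Lemma zclosed_prod_linear (T : Type) (r : seq T) (L : T -> V -> K) :
  (forall a, linear_for *%R (L a)) ->
  zclosed [set p : proj V | forall v, v \in pline p -> \prod_(a <- r) L a v = 0].
Proof.
move=> lL; pose f a : {mpoly K[\dim {:V}]} := \sum_(i < \dim {:V}) L a (vbasis {:V})`_i *: 'X_i.
have fE a v : (f a).@[fun i => coord (vbasis {:V}) i v] = L a v.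
  rewrite /f [in RHS](coord_vbasis (memvf v)) rmorph_sum /=.
  have LD x y : L a (x + y) = L a x + L a y by have := lL a 1 x y; rewrite scale1r mul1r.
  have L0 : L a 0 = 0 by apply: (addIr (L a 0)); rewrite -LD !add0r.
  rewrite (big_morph _ LD L0); apply: eq_bigr => i _; rewrite mevalZ mevalXU mulrC.
  by have := lL a (coord (vbasis {:V}) i v) (vbasis {:V})`_i 0; rewrite !addr0 L0 addr0 => ->.
have hf a : f a \is 1.-homog.
  by apply: rpred_sum => i _; apply: rpredZ; rewrite dhomogX /= mdeg1.
pose F := \prod_(a <- r) f a.
have hF : F \is (size r).-homog.
  rewrite /F; elim: r {F} => [|a r IH]; first by rewrite big_nil dhomog1.
  by rewrite big_cons /= -add1n; apply: dhomogM.
have FE v : F.@[fun i => coord (vbasis {:V}) i v] = \prod_(a <- r) L a v.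
  by rewrite /F rmorph_prod; apply: eq_bigr => a _; apply: fE.
exists [set F]; split; first by move=> _ ->; exists (size r).
apply/seteqP; split=> p /=; first by move=> h _ -> v vp; rewrite FE h.
by move=> h v vp; rewrite -FE; apply: h.
Qed.

Lemma zirreducible1 (p : proj V) : zirreducible [set p].
Proof.
split; first by exists p.
move=> A B _ _ h; have [Ap|Bp] := h p erefl; [left|right]; by move=> _ ->.
Qed.

End Closed.

Section Regular.
Variables (K : numClosedFieldType) (c : nat -> K).

Let r (k : 'I_3) (l : 'I_2) := elimp (perm_coef (lift k l) (lift k (rev_ord l)) k c).
Hypothesis r0 : forall k l, r k l != 0.
Hypothesis sepr : forall k l, separable_poly (r k l).

Lemma regular_reduced : subscheme_reduced (eigen_minor (cub c)).
Proof.
move=> k; set g := fun j => _ => p e; set J := ideal_gen g.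
apply: (@radical_of_separable K J (r k ord0) (r k ord_max)) => //.
- move=> p1 q1 [a ->] [b ->]; exists (fun j => a j + b j).
  by rewrite -big_split; apply: eq_bigr => j _; rewrite mulrDl.
- move=> p1 q1 [a ->]; exists (fun j => p1 * a j); rewrite big_distrr.
  by apply: eq_bigr => j _ /=; rewrite mulrA.
- exact: chart_elim.
- exact: chart_elim.
Qed.

Lemma meval_at_var (l : 'I_2) (p : {poly K}) (y : 'I_2 -> K) : (at_var l p).@[y] = p.[y l].
Proof.
elim/poly_ind: p => [|p a IH]; first by rewrite (_ : at_var l 0 = 0) ?meval0 ?horner0 ?raddf0.
by rewrite at_varD at_varM at_varX at_varC mevalD mevalM mevalXU mevalC IH hornerMXaddC.
Qed.

Lemma eigenpoint_root (p : proj 'rV[K]_3) (v : 'rV[K]_3) k l :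
  eigenpoints (cub c) p -> v \in pline p -> v 0 k = 1 -> root (r k l) (v 0 (lift k l)).
Proof.
move=> Ep vp vk; pose y l' := v 0 (lift k l').
have [a ea] := chart_elim k l c.
rewrite /root -[v 0 _]/(y l) -meval_at_var ea rmorph_sum /=; apply/eqP/big1 => j _.
rewrite mevalM; suff -> : (dehomog k (eigen_minor (cub c) j)).@[y] = 0 by rewrite mulr0.
rewrite -(Ep j v vp) /dehomog comp_mpoly_meval; apply: meval_eq => i.
rewrite tnth_mktuple; case: unliftP => [l'|] ->; last by rewrite meval1 vk.
by rewrite mevalXU.
Qed.

Lemma normalize_point (p : proj 'rV[K]_3) : exists k v, v \in pline p /\ v 0 k = 1.
Proof.
have [v vp v0] := pline_neq0 p.
have [k vk] : exists k, v 0 k != 0.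
  apply/not_existsP => h; case/eqP: v0; apply/rowP => k; rewrite mxE.
  by apply/eqP/negPn/negP; apply: h.
by exists k, ((v 0 k)^-1 *: v); rewrite memvZ // mxE mulVf.
Qed.

Lemma eq_point (p q : proj 'rV[K]_3) (v : 'rV[K]_3) k : v \in pline p -> v 0 k = 1 ->
  (forall l w, w \in pline q -> w 0 (lift k l) = v 0 (lift k l) * w 0 k) -> p = q.
Proof.
move=> vp vk h; apply: pline_inj; have [w wq w0] := pline_neq0 q.
have e : w = w 0 k *: v.
  apply/rowP => i; rewrite mxE; case: (unliftP k i) => [l|] ->; last by rewrite vk mulr1.
  by rewrite mulrC; apply: h.
have v0 : v != 0 by apply: contra_eq_neq vk => ->; rewrite mxE eq_sym oner_eq0.
have wp : w \in pline p by rewrite e memvZ.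
by rewrite (pline_line wp w0) (pline_line wq w0).
Qed.

(* The line x_(lift k l) = v_(lift k l) x_k through p and the other lines in the
   factorisation of [r k l] cover the eigenpoints. *)
Lemma irreducible_eigenpoint (C : set (proj 'rV[K]_3)) p :
  zirreducible C -> C `<=` eigenpoints (cub c) -> C p -> C `<=` [set p].
Proof.
move=> [_ irC] CE Cp q Cq; have [k [v [vp vk]]] := normalize_point p.
have lin (a : K) l : linear_for *%R (fun x : 'rV[K]_3 => x 0 (lift k l) - a * x 0 k).
  by move=> b x y; rewrite !mxE; ring.
have key l w : w \in pline q -> w 0 (lift k l) = v 0 (lift k l) * w 0 k.
  move=> wq; set rho := v 0 (lift k l).
  have [A eA] := closed_field_poly_normal (r k l).
  pose L (o : option K) (x : 'rV[K]_3) := if o is Some a then x 0 (lift k l) - a * x 0 k else x 0 k.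
  have linL o : linear_for *%R (L o).
    by case: o => [a|]; [exact: lin|move=> b x y; rewrite /= !mxE].
  (* [None] stands for the line x_k = 0, which contains the eigenpoints outside the chart. *)
  pose s := None :: [seq Some a | a <- A & a != rho].
  have cl := zclosed_prod_linear [:: Some rho] linL.
  have cl' := zclosed_prod_linear s linL.
  have [q'|h|h] := irC _ _ cl cl'.
  - move=> Cq'; have [w' w'q' w'0] := pline_neq0 q'.
    have line (w1 : 'rV[K]_3) : w1 \in pline q' -> exists b, w1 = b *: w'.
      by rewrite (pline_line w'q' w'0) => /vlineP.
    have LZ o b x : L o (b *: x) = b * L o x.
      by have := linL o b x 0; rewrite addr0 => ->; case: o => [a|]; rewrite /= !mxE ?mulr0 ?subr0 addr0.
    have [w'k|w'k] := eqVneq (w' 0 k) 0.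
      right=> w1 /line [b ->]; rewrite big_cons LZ /= w'k mulr0 mul0r //.
    pose w2 := (w' 0 k)^-1 *: w'.
    have := @eigenpoint_root q' w2 k l (CE _ Cq').
    rewrite memvZ // mxE mulVf // => /(_ isT erefl); rewrite /root eA hornerZ mulf_eq0.
    rewrite lead_coef_eq0 (negPf (r0 k l)) /= -/(root _ _) root_prod_XsubC mxE => rA.
    have Lw : L (Some ((w' 0 k)^-1 * w' 0 (lift k l))) w' = 0.
      by rewrite /L mulrAC mulVf // mul1r subrr.
    have [e|ne] := eqVneq ((w' 0 k)^-1 * w' 0 (lift k l)) rho.
      by left=> w1 /line [b ->]; rewrite big_seq1 LZ -e Lw mulr0.
    right=> w1 /line [b ->]; apply/eqP; rewrite prodf_seq_eq0; apply/hasP.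
    exists (Some ((w' 0 k)^-1 * w' 0 (lift k l))); last by apply/eqP; rewrite [LHS]LZ Lw mulr0.
    by rewrite inE map_f // mem_filter ne.
  - by have := h q Cq w wq; rewrite big_seq1 /= => /eqP; rewrite subr_eq0 => /eqP.
  - have := h p Cp v vp; rewrite big_cons /= vk mul1r => /eqP; rewrite prodf_seq_eq0.
    case/hasP => o /mapP [a]; rewrite mem_filter => /andP[aA _] -> /=.
    by rewrite vk mulr1 subr_eq0 eq_sym (negPf aA).
by apply/esym/(eq_point vp vk) => l w; apply: key.
Qed.

(** A point is an intersection of two lines, hence closed, and is a chain of length 0. In a longer
    chain the last member is irreducible, so reduces to a point taken from the first and cannot
    contain the first strictly. *)
Lemma regular_of_separable : eigenpoints (cub c) !=set0 -> eigen_regular (cub c).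
Proof.
move=> [p Ep]; split; first exact: regular_reduced.
split.
  exists (fun=> [set p]); split; last by move=> [[|i] hi] [[|j] hj].
  move=> _; split; [|exact: zirreducible1|by move=> _ ->].
  have [k [v [vp vk]]] := normalize_point p.
  have lin (a : K) l : linear_for *%R (fun x : 'rV[K]_3 => x 0 (lift k l) - a * x 0 k).
    by move=> b x y; rewrite !mxE; ring.
  pose L (l : 'I_2) (x : 'rV[K]_3) := x 0 (lift k l) - v 0 (lift k l) * x 0 k.
  have linL l : linear_for *%R (L l) by apply: lin.
  have := zclosedI (zclosed_prod_linear [:: ord0] linL)
                   (zclosed_prod_linear [:: ord_max] linL).
  congr zclosed; apply/seteqP; split=> [q [/= h0 h1]|_ -> /=].
    apply/esym/(eq_point vp vk); apply: ord2P => w wq.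
      by have := h0 w wq; rewrite big_seq1 => /eqP; rewrite subr_eq0 => /eqP.
    by have := h1 w wq; rewrite big_seq1 => /eqP; rewrite subr_eq0 => /eqP.
  have v0 : v != 0 by apply: contra_eq_neq vk => ->; rewrite mxE eq_sym oner_eq0.
  by split=> w; rewrite (pline_line vp v0) => /vlineP [b ->];
    rewrite big_seq1 /L !mxE vk mulr1 mulrC subrr.
move=> [|m] // [d [hd lt]].
have [cl0 [[q d0q] _] sub0] := hd ord0; have [cl1 ir1 sub1] := hd ord_max.
have [s01 ns] := lt ord0 ord_max isT.
by case: ns => q' /(irreducible_eigenpoint ir1 sub1 (s01 _ d0q)) ->.
Qed.

End Regular.

(** * Coordinates on cubic forms *)

Section LinearSubstitution.
Variables (K : fieldType) (n m : nat) (A : 'I_n -> 'I_m -> K).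

Definition lin_subst (p : {mpoly K[n]}) : {mpoly K[m]} :=
  p \mPo [tuple \sum_j A i j *: 'X_j | i < n].

Lemma meval_lin_subst p x : (lin_subst p).@[x] = p.@[fun i => \sum_j A i j * x j].
Proof.
rewrite /lin_subst comp_mpoly_meval; apply: meval_eq => i.
by rewrite tnth_mktuple rmorph_sum; apply: eq_bigr => j _; rewrite /= mevalZ mevalXU.
Qed.

Lemma lin_subst_homog k p : p \is k.-homog -> lin_subst p \is k.-homog.
Proof.
move=> hp; rewrite /lin_subst comp_mpolyE; rewrite big_seq; apply: rpred_sum => mm mp.
apply: rpredZ; rewrite -(dhomogP _ _ _ hp _ mp) /= mdegE.
have hX i : tnth [tuple \sum_j A i j *: 'X_j | i < n] i \is 1.-homog.
  by rewrite tnth_mktuple; apply: rpred_sum => j _; apply: rpredZ; rewrite dhomogX /= mdeg1.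
elim: (index_enum _) => [|i r IH]; first by rewrite !big_nil dhomog1.
rewrite !big_cons; apply: dhomogM => //.
by have := dhomogMn (mm i) (hX i); rewrite mul1n.
Qed.

End LinearSubstitution.

Definition mon3 (k : nat) : 'X_{1..3} :=
  [multinom nth 0%N (nth [::] cubic_exponents k) i | i < 3].

Section Coordinates.
Variable K : fieldType.

Lemma big_ord3 (R : Type) (idx : R) (op : Monoid.law idx) (F : 'I_3 -> R) :
  \big[op/idx]_(i < 3) F i = op (op (F o0) (F o1)) (F o2).
Proof.
rewrite !big_ord_recl big_ord0 Monoid.mulm1 Monoid.mulmA.
by congr (op (op (F _) (F _)) (F _)); apply: val_inj.
Qed.

Lemma mon3_cover (m : 'X_{1..3}) : mdeg m = 3 -> exists2 k, (k < 10)%N & m = mon3 k.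
Proof.
rewrite mdegE big_ord3 /= => e.
have {e} : [:: m o0; m o1; m o2] \in cubic_exponents.
  move: e.
  by case: (m o0) => [|[|[|[|a]]]]; case: (m o1) => [|[|[|[|b]]]]; case: (m o2) => [|[|[|[|d]]]];
    rewrite ?addnS ?addSn.
move=> /(nthP [::]) [k k10 ek]; exists k => //; apply/mnmP.
by apply: ord3P; rewrite mnmE ek.
Qed.

Lemma mdeg_mon3 (k : 'I_10) : mdeg (mon3 k) = 3.
Proof.
by rewrite mdegE big_ord3 !mnmE /=; case: k => -[|[|[|[|[|[|[|[|[|[|]]]]]]]]]].
Qed.

Lemma mon3_inj (k l : nat) : (k < 10)%N -> (l < 10)%N -> (mon3 k == mon3 l) = (k == l).
Proof.
move=> k10 l10; apply/eqP/eqP => [|-> //] e.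
have E j : (j < 10)%N -> nth [::] cubic_exponents j = [:: mon3 j o0; mon3 j o1; mon3 j o2].
  by rewrite !mnmE; do 10! [case: j => [|j] //].
by apply/eqP; rewrite -(nth_uniq [::] _ _ (isT : uniq cubic_exponents)) ?E ?e.
Qed.

Lemma cub_sum (c : nat -> K) : cub c = \sum_(k < 10) c k *: 'X_[mon3 k].
Proof.
have X a b d : 'X_o0 ^+ a * 'X_o1 ^+ b * 'X_o2 ^+ d
    = 'X_[[multinom nth 0%N [:: a; b; d] i | i < 3]] :> {mpoly K[3]}.
  by rewrite [RHS]mpolyXE_id big_ord3 !mnmE.
rewrite /cub /cubic !big_ord_recr big_ord0 /= add0r /mon3 /= -!X -!mul_mpolyC !expr0 !expr1 !mulr1 !mul1r.
by rewrite !mulrA.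
Qed.

Definition cf (v : 'rV[K]_10) (k : nat) : K := v 0 (inord k).

Lemma cub_homog c : cub c \is [in K[3], 3.-homog].
Proof.
by rewrite cub_sum; apply: rpred_sum => k _; apply: rpredZ; rewrite dhomogX /= mdeg_mon3.
Qed.

Definition cubd (v : 'rV[K]_10) : dhomog 3 K 3 := DHomog (cub_homog (cf v)).

Definition coefs (f : dhomog 3 K 3) : 'rV[K]_10 := \row_k (val f)@_(mon3 k).

Lemma cubdK : cancel cubd coefs.
Proof.
move=> v; apply/rowP => k; rewrite mxE /= cub_sum raddf_sum /= (bigD1 k) //=.
rewrite mcoeffZ mcoeffX eqxx mulr1 /cf inord_val big1 ?addr0 // => l lk.
by rewrite mcoeffZ mcoeffX mon3_inj // (negPf (lk : val l != val k)) mulr0.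
Qed.

Lemma coefsK : cancel coefs cubd.
Proof.
move=> f; apply: val_inj; apply/mpolyP => m; rewrite /= cub_sum raddf_sum /=.
have [m3|m3] := eqVneq (mdeg m) 3; last first.
  rewrite (dhomog_nemf_coeff (valP f)) // big1 // => k _; rewrite mcoeffZ mcoeffX.
  case: eqP => [e|]; last by rewrite mulr0.
  by rewrite -e mdeg_mon3 eqxx in m3.
have [k k10 ->] := mon3_cover m3; rewrite (bigD1 (Ordinal k10)) //= mcoeffZ mcoeffX eqxx mulr1.
rewrite /cf mxE inordK // big1 ?addr0 // => l lk.
by rewrite mcoeffZ mcoeffX mon3_inj // (negPf (lk : val l != k)) mulr0.
Qed.

Lemma coefs_linear : linear coefs.
Proof. by move=> a f g; apply/rowP => k; rewrite !mxE /= mcoeffD mcoeffZ. Qed.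

HB.instance Definition _ := GRing.isLinear.Build K (dhomog 3 K 3) 'rV[K]_10 *:%R coefs coefs_linear.

Lemma cubd_linear : linear cubd.
Proof. by move=> a v w; apply: (can_inj coefsK); rewrite coefs_linear !cubdK. Qed.

HB.instance Definition _ := GRing.isLinear.Build K 'rV[K]_10 (dhomog 3 K 3) *:%R cubd cubd_linear.

(** The topology is defined in the coordinates of [vbasis], the computations use the ten
    coefficients; this and [mpoly_coord] pass between them by a linear substitution. *)
Lemma coord_mpoly (F : {mpoly K[\dim {: dhomog 3 K 3}]}) :
  exists H : {mpoly K[10]}, forall f : dhomog 3 K 3,
    H.@[coefs f 0] = F.@[fun i => coord (vbasis {: dhomog 3 K 3}) i f].
Proof.
exists (lin_subst (fun i j => coord (vbasis {: dhomog 3 K 3}) i (cubd (delta_mx 0 j))) F).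
move=> f; rewrite meval_lin_subst; apply: meval_eq => i.
rewrite -{2}(coefsK f) {2}(row_sum_delta (coefs f)) !linear_sum /=; apply: eq_bigr => j _.
by rewrite !linearZ /= mulrC.
Qed.

Lemma mpoly_coord k (H : {mpoly K[10]}) : H \is k.-homog ->
  exists F : {mpoly K[\dim {: dhomog 3 K 3}]}, F \is k.-homog /\ forall f : dhomog 3 K 3,
    F.@[fun i => coord (vbasis {: dhomog 3 K 3}) i f] = H.@[coefs f 0].
Proof.
move=> hH; exists (lin_subst (fun j i => coefs (vbasis {: dhomog 3 K 3})`_i 0 j) H).
split; first exact: lin_subst_homog.
move=> f; rewrite meval_lin_subst; apply: meval_eq => j.
rewrite {2}(coord_vbasis (memvf f)) linear_sum summxE /=; apply: eq_bigr => i _.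
by rewrite linearZ [RHS]mxE mulrC.
Qed.

End Coordinates.

(** * Cubics with aligned eigenpoints *)

Section Cross.
Variable K : comNzRingType.
Implicit Types u v w : 'rV[K]_3.

Definition vec3 (a b d : K) : 'rV[K]_3 := \row_(i < 3) nth 0 [:: a; b; d] i.

Lemma vec3E a b d : ((vec3 a b d 0 o0 = a) * (vec3 a b d 0 o1 = b) * (vec3 a b d 0 o2 = d))%type.
Proof. by rewrite !mxE. Qed.

Lemma vec3P u v : u 0 o0 = v 0 o0 -> u 0 o1 = v 0 o1 -> u 0 o2 = v 0 o2 -> u = v.
Proof. by move=> e0 e1 e2; apply/rowP; apply: ord3P. Qed.

Definition cross u v : 'rV[K]_3 :=
  vec3 (u 0 o1 * v 0 o2 - u 0 o2 * v 0 o1) (u 0 o2 * v 0 o0 - u 0 o0 * v 0 o2)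
       (u 0 o0 * v 0 o1 - u 0 o1 * v 0 o0).

Definition dot u v : K := u 0 o0 * v 0 o0 + u 0 o1 * v 0 o1 + u 0 o2 * v 0 o2.

Definition gradient (c : nat -> K) v : 'rV[K]_3 := \row_i grad3 c (v 0) i.

Definition polar c n v := dot n (gradient c v).

Lemma polarE c n v : polar c n v =
  n 0 o0 * cubic_x c (v 0 o0) (v 0 o1) (v 0 o2) + n 0 o1 * cubic_y c (v 0 o0) (v 0 o1) (v 0 o2)
  + n 0 o2 * cubic_z c (v 0 o0) (v 0 o1) (v 0 o2).
Proof. by rewrite /polar /dot /gradient !mxE. Qed.

(** For fixed n this is a quadratic form in (s, t), determined by its values at (1, 0), (0, 1) and
    (1, 1). *)
Lemma polar_span c n u w s t :
  polar c n (s *: u + t *: w) = s * (s - t) * polar c n u + t * (t - s) * polar c n w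
                                + s * t * polar c n (u + w).
Proof. rewrite !polarE !mxE /cubic_x /cubic_y /cubic_z; ring. Qed.

(* Coefficients of the product of the linear forms l, l and m. *)
Definition sqr_lin (l m : 'rV[K]_3) (k : nat) : K :=
  let l0 := l 0 o0 in let l1 := l 0 o1 in let l2 := l 0 o2 in
  let m0 := m 0 o0 in let m1 := m 0 o1 in let m2 := m 0 o2 in
  nth 0 [:: l0 ^+ 2 * m0; l0 ^+ 2 * m1 + l0 * l1 * m0 *+ 2; l0 ^+ 2 * m2 + l0 * l2 * m0 *+ 2;
            l1 ^+ 2 * m0 + l0 * l1 * m1 *+ 2; l2 ^+ 2 * m0 + l0 * l2 * m2 *+ 2;
            l1 ^+ 2 * m1; l1 ^+ 2 * m2 + l1 * l2 * m1 *+ 2; l2 ^+ 2 * m1 + l1 * l2 * m2 *+ 2;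
            l2 ^+ 2 * m2; (l0 * l1 * m2 + l0 * l2 * m1 + l1 * l2 * m0) *+ 2] k.

Lemma polar_sqr_lin l m n v :
  polar (sqr_lin l m) n v = dot l n * dot l v * dot m v *+ 2 + dot m n * dot l v ^+ 2.
Proof.
rewrite polarE /cubic_x /cubic_y /cubic_z /sqr_lin /= /dot; ring.
Qed.

End Cross.

Section Param.
Variable K : numClosedFieldType.
Implicit Types (u w v n : 'rV[K]_3) (f : 'rV[K]_10).

Definition aligned_by f u w := [/\ polar (cf f) (cross u w) u = 0,
  polar (cf f) (cross u w) w = 0 & polar (cf f) (cross u w) (u + w) = 0].

(* By [polar_span] these three conditions say that on the whole plane spanned by u
   and w the gradient of f is orthogonal to the normal. *)
Definition aligned f := exists u w, cross u w != 0 /\ aligned_by f u w.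

Definition cond_pt u w (k : 'I_3) := nth 0 [:: u; w; u + w] k.

Definition cond_mx u w : 'M[K]_(10, 3) :=
  \matrix_(m, k) polar (fun j => (j == m)%:R) (cross u w) (cond_pt u w k).

Lemma cond_mxE f u w k : (f *m cond_mx u w) 0 k = polar (cf f) (cross u w) (cond_pt u w k).
Proof.
rewrite mxE polarE; under eq_bigr => i _ do rewrite mxE polarE -[X in f 0 X]inord_val -/(cf f i).
rewrite !big_ord_recr big_ord0 /= /cubic_x /cubic_y /cubic_z.
move: (cross u w 0 o0) (cross u w 0 o1) (cross u w 0 o2) => n0 n1 n2.
move: (cond_pt u w k 0 o0) (cond_pt u w k 0 o1) (cond_pt u w k 0 o2) => x y z; rewrite !eqE /=; ring.
Qed.

Lemma cond_mx0 f u w : aligned_by f u w <-> f *m cond_mx u w = 0.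
Proof.
split=> [[e0 e1 e2]|e].
  by apply/rowP; apply: ord3P; rewrite cond_mxE mxE.
by split; [have := cond_mxE f u w o0|have := cond_mxE f u w o1|have := cond_mxE f u w o2];
  rewrite e mxE.
Qed.

Lemma cross_eq0 u w : cross u w = 0 -> cond_mx u w = 0.
Proof.
move=> e; apply/matrixP => i k; rewrite !mxE e polarE !mxE !mul0r !addr0 //.
Qed.

Lemma exists_form u w (a b : K) : cross u w != 0 -> exists l, dot l u = a /\ dot l w = b.
Proof.
have [e0 ne|n0 _] := eqVneq (cross u w 0 o0) 0; last first.
  exists (vec3 0 ((a * w 0 o2 - b * u 0 o2) / cross u w 0 o0)
                 ((b * u 0 o1 - a * w 0 o1) / cross u w 0 o0)).
  move: n0; rewrite /dot /cross !vec3E => n0; split; field; exact: n0.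
have [e1|n1] := eqVneq (cross u w 0 o1) 0; last first.
  exists (vec3 ((b * u 0 o2 - a * w 0 o2) / cross u w 0 o1) 0
                 ((a * w 0 o0 - b * u 0 o0) / cross u w 0 o1)).
  move: n1; rewrite /dot /cross !vec3E => n1; split; field; exact: n1.
have [e2|n2] := eqVneq (cross u w 0 o2) 0; last first.
  exists (vec3 ((a * w 0 o1 - b * u 0 o1) / cross u w 0 o2)
                 ((b * u 0 o0 - a * w 0 o0) / cross u w 0 o2) 0).
  move: n2; rewrite /dot /cross !vec3E => n2; split; field; exact: n2.
by case/eqP: ne; apply: vec3P; rewrite [RHS]mxE.
Qed.

Lemma exists_dual n : n != 0 -> exists m, dot m n = 1.
Proof.
move=> n0; have [k nk] : exists k, n 0 k != 0.
  apply/not_existsP => h; case/eqP: n0; apply/rowP => k; rewrite [RHS]mxE.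
  by apply/eqP/negPn/negP; apply: h.
by move: k nk; apply: ord3P => nk; [exists (vec3 (n 0 o0)^-1 0 0)|exists (vec3 0 (n 0 o1)^-1 0)
  |exists (vec3 0 0 (n 0 o2)^-1)]; rewrite /dot !vec3E !mul0r ?add0r ?addr0 mulVf.
Qed.

(** A relation y between the three conditions, tested on cubics divisible by the square of a linear
    form l, becomes a relation between l(u)^2, l(w)^2 and l(u + w)^2. As l(u) and l(w) are
    arbitrary, y = 0. *)
Lemma row_full_cond u w : cross u w != 0 -> row_full (cond_mx u w).
Proof.
move=> n0; rewrite /row_full -mxrank_tr -/(row_free _); apply: inj_row_free => y ey.
set n := cross u w in n0.
have key (c : nat -> K) : \sum_k y 0 k * polar c n (cond_pt u w k) = 0.
  pose f : 'rV[K]_10 := \row_k c k.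
  have fc : polar (cf f) n = polar c n.
    apply/funext => v; rewrite !polarE /cubic_x /cubic_y /cubic_z /cf /f !mxE !inordK //.
  have : (f *m (cond_mx u w *m y^T)) 0 0 = 0.
    by rewrite -[cond_mx u w]trmxK -trmx_mul ey trmx0 mulmx0 mxE.
  rewrite mulmxA mxE => h; rewrite -[RHS]h; apply: eq_bigr => k _.
  by rewrite cond_mxE -/n fc mxE mulrC.
have [m em] := exists_dual n0.
have sq l : \sum_k y 0 k * dot l (cond_pt u w k) ^+ 2 = 0.
  (* The test cubic is l^2 m with m(n) = 1 when l(n) = 0, and l^3 otherwise. *)
  have [ln|ln] := eqVneq (dot l n) 0.
    rewrite -[RHS](key (sqr_lin l m)); apply: eq_bigr => k _.
    by rewrite polar_sqr_lin ln em !mul0r mul0rn add0r mul1r.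
  apply: (mulfI ln); apply: (mulfI (_ : 3%:R != 0 :> K)); first by rewrite pnatr_eq0.
  rewrite !mulr0 -[RHS](key (sqr_lin l l)) !big_distrr /=; apply: eq_bigr => k _.
  by rewrite polar_sqr_lin; ring.
have val a b : y 0 o0 * a ^+ 2 + y 0 o1 * b ^+ 2 + y 0 o2 * (a + b) ^+ 2 = 0.
  have [l [la lb]] := exists_form a b n0; rewrite -[RHS](sq l) big_ord3 /= -la -lb.
  by congr (_ + _ * _ ^+ 2); rewrite /dot !mxE; ring.
have v1 := val 1 0; have v2 := val 0 1; have v3 := val 1 1.
have y2 : y 0 o2 = 0.
  apply: (mulfI (_ : 2%:R != 0 :> K)); first by rewrite pnatr_eq0.
  have e (a b d : K) : 2%:R * d = a * 1 ^+ 2 + b * 1 ^+ 2 + d * (1 + 1) ^+ 2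
      - (a * 1 ^+ 2 + b * 0 ^+ 2 + d * (1 + 0) ^+ 2) - (a * 0 ^+ 2 + b * 1 ^+ 2 + d * (0 + 1) ^+ 2).
    by ring.
  by rewrite mulr0 (e (y 0 o0) (y 0 o1)) v1 v2 v3 !subr0.
move: v1 v2; rewrite y2 !mul0r !expr1n !expr0n /= !mulr0 !mulr1 !addr0 add0r => y0 y1.
by apply: vec3P; rewrite [RHS]mxE.
Qed.

(* With A the matrix of the conditions and B = T A, this is the projection
   1 - A B^-1 T onto the kernel of A, multiplied by det B to make it polynomial. *)
Definition cubic_family (t : 'M[K]_(2, 3) * 'M[K]_(3, 10) * 'rV[K]_10) : 'rV[K]_10 :=
  let A := cond_mx (row ord0 t.1.1) (row ord_max t.1.1) in
  let B := t.1.2 *m A in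
  \det B *: t.2 - t.2 *m A *m \adj B *m t.1.2.

Lemma cubic_family_cond t : cubic_family t *m cond_mx (row ord0 t.1.1) (row ord_max t.1.1) = 0.
Proof.
rewrite /cubic_family mulmxBl -scalemxAl -!mulmxA mul_adj_mx.
by rewrite mul_mx_scalar -scalemxAr subrr.
Qed.

Lemma cubic_family_aligned t : aligned (cubic_family t).
Proof.
have [e|ne] := eqVneq (cross (row ord0 t.1.1) (row ord_max t.1.1)) 0; last first.
  exists (row ord0 t.1.1), (row ord_max t.1.1).
  by have /cond_mx0 [h0 h1 h2] := cubic_family_cond t.
(* Parallel u and w annihilate both terms of the family, and the zero cubic satisfies the conditions
   for any plane. *)
have -> : cubic_family t = 0.
  by rewrite /cubic_family (cross_eq0 e) !(mulmx0, mul0mx) subr0 det0 scale0r.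
have z (v v' : 'rV[K]_3) : polar (cf (0 : 'rV[K]_10)) v v' = 0.
  by rewrite polarE /cubic_x /cubic_y /cubic_z /cf !mxE; ring.
exists (vec3 1 0 0), (vec3 0 1 0); split; rewrite ?z //.
apply/eqP => /(congr1 (fun v : 'rV[K]_3 => v 0 o2)); rewrite /cross !vec3E mxE mulr0 mulr1 subr0.
by move/eqP; rewrite oner_eq0.
Qed.

(** The conditions being independent, T can be a left inverse of A; then B = 1 and the projection
    fixes f. *)
Lemma cubic_family_surj u w f : cross u w != 0 -> f *m cond_mx u w = 0 ->
  exists x, [/\ cubic_family x = f, row ord0 x.1.1 = u & row ord_max x.1.1 = w].
Proof.
move=> n0 fM; have /row_fullP [F FM] := row_full_cond n0.
pose P : 'M[K]_(2, 3) := \matrix_(i, j) (if i == ord0 then u 0 j else w 0 j).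
have P0 : row ord0 P = u by apply/rowP => j; rewrite !mxE eqxx.
have P1 : row ord_max P = w by apply/rowP => j; rewrite !mxE.
exists (P, F, f); split=> //=.
by rewrite /cubic_family /= P0 P1 FM det1 scale1r fM !mul0mx subr0.
Qed.

End Param.

Ltac line_poly := lazymatch goal with
  | |- lpoly (fun w => @?g w + @?h w) => apply: (@lpolyD _ _ g h); line_poly
  | |- lpoly (fun w => - @?g w) => apply: (@lpolyN _ _ g); line_poly
  | |- lpoly (fun w => @?g w *+ ?n) => apply: (@lpolyMn _ _ g n); line_poly
  | |- lpoly (fun w => @?g w * @?h w) => apply: (@lpolyM _ _ g h); line_poly
  | |- lpoly (fun w => @?g w ^+ ?n) => apply: (@lpolyX _ _ g n); line_poly
  | |- _ => first [by auto | exact: lpolyC]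
  end.

Section LpolyMatrix.
Variables (K : numFieldType) (W : lmodType K).

Lemma lpoly_mulmx m n p (A : W -> 'M[K]_(m, n)) (B : W -> 'M[K]_(n, p)) :
  (forall i j, lpoly (fun w => A w i j)) -> (forall i j, lpoly (fun w => B w i j)) ->
  forall i j, lpoly (fun w => (A w *m B w) i j).
Proof.
move=> hA hB i j; have -> : (fun w => (A w *m B w) i j) = fun w => \sum_k A w i k * B w k j.
  by apply/funext => w; rewrite mxE.
by apply: lpoly_sum => k; line_poly.
Qed.

Lemma lpoly_adj n (A : W -> 'M[K]_n) : (forall i j, lpoly (fun w => A w i j)) ->
  forall i j, lpoly (fun w => (\adj (A w)) i j).
Proof.
move=> hA i j; have -> : (fun w => (\adj (A w)) i j) =
    fun w => (-1) ^+ (j + i) * \det (row' j (col' i (A w))).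
  by apply/funext => w; rewrite mxE.
apply: lpolyM; first exact: lpolyC.
apply: lpoly_det => k l; have -> : (fun w => (row' j (col' i (A w))) k l) = fun w => A w (lift j k) (lift i l).
  by apply/funext => w; rewrite !mxE.
exact: hA.
Qed.

Lemma lpoly_cross (u v : W -> 'rV[K]_3) :
  (forall i, lpoly (fun w => u w 0 i)) -> (forall i, lpoly (fun w => v w 0 i)) ->
  forall i, lpoly (fun w => cross (u w) (v w) 0 i).
Proof.
move=> hu hv; apply: ord3P.
- rewrite (_ : (fun w => _) = fun w => u w 0 o1 * v w 0 o2 - u w 0 o2 * v w 0 o1); first by line_poly.
  by apply/funext => w; rewrite /cross vec3E.
- rewrite (_ : (fun w => _) = fun w => u w 0 o2 * v w 0 o0 - u w 0 o0 * v w 0 o2); first by line_poly.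
  by apply/funext => w; rewrite /cross vec3E.
- rewrite (_ : (fun w => _) = fun w => u w 0 o0 * v w 0 o1 - u w 0 o1 * v w 0 o0); first by line_poly.
  by apply/funext => w; rewrite /cross vec3E.
Qed.

Lemma lpoly_polar c (n v : W -> 'rV[K]_3) :
  (forall i, lpoly (fun w => n w 0 i)) -> (forall i, lpoly (fun w => v w 0 i)) ->
  lpoly (fun w => polar c (n w) (v w)).
Proof.
move=> hn hv; rewrite (_ : (fun w => _) = fun w =>
  n w 0 o0 * cubic_x c (v w 0 o0) (v w 0 o1) (v w 0 o2) + n w 0 o1 * cubic_y c (v w 0 o0) (v w 0 o1) (v w 0 o2)
  + n w 0 o2 * cubic_z c (v w 0 o0) (v w 0 o1) (v w 0 o2)).
  by rewrite /cubic_x /cubic_y /cubic_z; line_poly.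
by apply/funext => w; apply: polarE.
Qed.

End LpolyMatrix.

Section Family.
Variable K : numClosedFieldType.
Local Notation W := ('M[K]_(2, 3) * 'M[K]_(3, 10) * 'rV[K]_10)%type.

Lemma lpoly_pt (i : 'I_2) j : lpoly (fun t : W => row i t.1.1 0 j).
Proof. by apply: lpoly_linear => a x y; rewrite !mxE. Qed.

Lemma lpoly_family j : lpoly (fun t : W => cubic_family t 0 j).
Proof.
have h1 i k : lpoly (fun t : W => t.1.2 i k) by apply: lpoly_linear => a x y; rewrite !mxE.
have h2 i k : lpoly (fun t : W => t.2 i k) by apply: lpoly_linear => a x y; rewrite !mxE.
have hn := lpoly_cross (lpoly_pt ord0) (lpoly_pt ord_max).
have hA i k : lpoly (fun t : W => cond_mx (row ord0 t.1.1) (row ord_max t.1.1) i k).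
  rewrite (_ : (fun t => _) = fun t : W => polar (fun j => (j == i)%:R)
    (cross (row ord0 t.1.1) (row ord_max t.1.1)) (cond_pt (row ord0 t.1.1) (row ord_max t.1.1) k)); last first.
    by apply/funext => t; rewrite mxE.
  apply: lpoly_polar => // l; move: k; apply: ord3P; rewrite /cond_pt /=; try exact: lpoly_pt.
  rewrite (_ : (fun t => _) = fun t : W => row ord0 t.1.1 0 l + row ord_max t.1.1 0 l).
    by apply: lpolyD; apply: lpoly_pt.
  by apply/funext => t; rewrite mxE.
have hB := lpoly_mulmx h1 hA.
rewrite (_ : (fun t => _) = fun t : W =>
  \det (t.1.2 *m cond_mx (row ord0 t.1.1) (row ord_max t.1.1)) * t.2 0 j
  - (t.2 *m cond_mx (row ord0 t.1.1) (row ord_max t.1.1)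
     *m \adj (t.1.2 *m cond_mx (row ord0 t.1.1) (row ord_max t.1.1)) *m t.1.2) 0 j); last first.
  by apply/funext => t; rewrite mxE [X in X + _]mxE [X in _ + X]mxE.
apply: lpolyB; first by apply: lpolyM; [exact: lpoly_det|].
by apply: lpoly_mulmx => //; apply: lpoly_mulmx; [exact: lpoly_mulmx|exact: lpoly_adj].
Qed.

(* The third coordinate of v x grad f(v) at v = s u + w, as a polynomial in s. *)
Definition line_poly_of (c : nat -> K) (u w : 'rV[K]_3) : {poly K} :=
  let V i := (u 0 i)%:P * 'X + (w 0 i)%:P in
  let C n := (c n)%:P in
  V o0 * cubic_y C (V o0) (V o1) (V o2) - V o1 * cubic_x C (V o0) (V o1) (V o2).

Lemma size_line_poly c u w : (size (line_poly_of c u w) <= 4)%N.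
Proof.
rewrite /line_poly_of; pose V i := (u 0 i)%:P * 'X + (w 0 i)%:P; rewrite -!/(V _).
have hV i : degle 1 (V i) by rewrite /V; bound_degree.
have h0 := hV o0; have h1 := hV o1; have h2 := hV o2.
move: (V o0) (V o1) (V o2) h0 h1 h2 => x y z h0 h1 h2.
have hx : degle 2 (cubic_x (fun n => (c n)%:P) x y z) by rewrite /cubic_x; bound_degree.
have hy : degle 2 (cubic_y (fun n => (c n)%:P) x y z) by rewrite /cubic_y; bound_degree.
by rewrite -/(degle 3 _); bound_degree.
Qed.

Lemma horner_line_poly c u w s : (line_poly_of c u w).[s] =
  cross (s *: u + w) (gradient c (s *: u + w)) 0 o2.
Proof.
rewrite /line_poly_of /cross vec3E !mxE /grad3 /= /cubic_x /cubic_y.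
rewrite !(hornerD, hornerN, hornerM, hornerMn, horner_exp, hornerC, hornerX) !mxE.
by rewrite ![s * _]mulrC.
Qed.

Lemma lpolyp_line_poly :
  lpolyp (fun t : W => line_poly_of (cf (cubic_family t)) (row ord0 t.1.1) (row ord_max t.1.1)).
Proof.
have hp := lpoly_pt; have hc n : lpoly (fun t : W => cf (cubic_family t) n) by apply: lpoly_family.
by rewrite /line_poly_of /cubic_x /cubic_y; line_polyp.
Qed.

(* The determinants over k and l make all the chart resultants separable, which
   yields regularity; the other factors give three distinct eigenpoints on the
   line spanned by u and w. *)
Definition generic (t : W) : K :=
  (\prod_(k < 3) \prod_(l < 2)
     \det (disc_mx 6 (elimp (perm_coef (lift k l) (lift k (rev_ord l)) k (cf (cubic_family t))))))
  * \det (disc_mx 2 (line_poly_of (cf (cubic_family t)) (row ord0 t.1.1) (row ord_max t.1.1)))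
  * (line_poly_of (cf (cubic_family t)) (row ord0 t.1.1) (row ord_max t.1.1))`_3
  * cross (row ord0 t.1.1) (row ord_max t.1.1) 0 o2.

Lemma lpoly_generic : lpoly generic.
Proof.
have hc n : lpoly (fun t : W => cf (cubic_family t) n) by apply: lpoly_family.
rewrite /generic; apply: lpolyM; last exact: (lpoly_cross (lpoly_pt ord0) (lpoly_pt ord_max)).
apply: lpolyM; last exact: lpolyp_line_poly.
apply: lpolyM; last exact: lpoly_disc lpolyp_line_poly.
apply: lpoly_prod => k; apply: lpoly_prod => l; apply: lpoly_disc; apply: lpolyp_elimp => n.
exact: hc.
Qed.

End Family.

Section Eigenpoints.
Variable K : numClosedFieldType.
Implicit Types (u w v : 'rV[K]_3) (c : nat -> K).

Lemma exists_point (V : vectType K) (v : V) : v != 0 -> exists p : proj V, pline p = <[v]>%VS.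
Proof.
move=> v0; have h : \dim <[v]> == 1%N by rewrite dim_vline v0.
by exists (exist (fun U : {vspace V} => \dim U == 1%N) <[v]>%VS h).
Qed.

Lemma meval_minor c m v : (eigen_minor (cub c) m).@[v 0] =
  v 0 (lift m ord0) * gradient c v 0 (lift m ord_max) - v 0 (lift m ord_max) * gradient c v 0 (lift m ord0).
Proof.
rewrite eigen_minorE mevalB !mevalM !mevalXU !mderiv_cub.
have e i : (grad3 (fun n => (c n)%:MP) (fun j => 'X_j) i).@[v 0] = gradient c v 0 i.
  transitivity (grad3 (meval (v 0) \o (fun n => (c n)%:MP)) (meval (v 0) \o (fun j => 'X_j)) i).
    exact: (rmorph_grad3 (meval (v 0))).
  rewrite mxE; congr grad3; apply/funext => j /=; first exact: mevalC.
  exact: mevalXU.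
by rewrite !e.
Qed.

Lemma gradientZ c b v : gradient c (b *: v) = b ^+ 2 *: gradient c v.
Proof.
by apply: vec3P; rewrite !mxE /grad3 /= /cubic_x /cubic_y /cubic_z !mxE; ring.
Qed.

Lemma eigenpoint_cross c p v : v \in pline p -> v != 0 ->
  eigenpoints (cub c) p <-> cross v (gradient c v) = 0.
Proof.
move=> vp v0; split=> [Ep|e].
  have E m := Ep m v vp; apply: vec3P; rewrite /cross vec3E [RHS]mxE.
  - by have := E o0; rewrite meval_minor !lift3E.
  - by have := E o1; rewrite meval_minor !lift3E => e; apply: oppr_inj; rewrite oppr0 opprB.
  - by have := E o2; rewrite meval_minor !lift3E.
move=> m w; rewrite (pline_line vp v0) => /vlineP [b ->].
have h : (eigen_minor (cub c) m).@[v 0] = 0.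
  have E i : cross v (gradient c v) 0 i = 0 by rewrite e mxE.
  move: m; apply: ord3P; rewrite meval_minor !lift3E.
  - by have := E o0; rewrite /cross vec3E.
  - by have := E o1; rewrite /cross vec3E => h; apply: oppr_inj; rewrite oppr0 opprB.
  - by have := E o2; rewrite /cross vec3E.
have Z (s : K) (x : 'rV[K]_3) i : (s *: x) 0 i = s * x 0 i by rewrite mxE.
rewrite meval_minor gradientZ !Z.
have -> (x y z t : K) : b * x * (b ^+ 2 * y) - b * z * (b ^+ 2 * t) = b ^+ 3 * (x * y - z * t) by ring.
by rewrite -meval_minor h mulr0.
Qed.

Lemma elimp_ext c c' : (forall n, (n < 10)%N -> c n = c' n) -> elimp c = elimp c'.
Proof.
by move=> e; rewrite /elimp /elim (e 0%N) ?(e 1%N) ?(e 2) ?(e 3) ?(e 4) ?(e 5) ?(e 6) ?(e 7) ?(e 8) ?(e 9).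
Qed.

Lemma elimp0 : elimp (fun=> 0) = 0 :> {poly K}.
Proof.
rewrite /elimp /elim polyC0 !(mul0r, mul0rn, addr0, subr0, oppr0).
by rewrite /res32 !(mul0r, mul0rn, addr0, subr0, expr0n).
Qed.

Lemma cross0v v : cross 0 v = 0.
Proof. by apply: vec3P; rewrite /cross !vec3E !mxE; ring. Qed.

Lemma crossvv v : cross v v = 0.
Proof. by apply: vec3P; rewrite /cross !vec3E mxE; ring. Qed.

Lemma cross_lin u w (s t a b : K) :
  cross (s *: u + t *: w) (a *: u + b *: w) = (s * b - t * a) *: cross u w.
Proof. by apply: vec3P; rewrite /cross !(vec3E, mxE); ring. Qed.

Lemma dot_cross u w s t : dot (cross u w) (s *: u + t *: w) = 0.
Proof. by rewrite /dot /cross !vec3E !mxE; ring. Qed.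

(** By n x (v x g) = (n.g) v - (n.v) g = 0, the vector v x g is parallel to n, and its third
    coordinate decides whether it is zero. *)
Lemma cross_orthogonal n v g : dot n v = 0 -> dot n g = 0 -> n 0 o2 != 0 ->
  cross v g 0 o2 = 0 -> cross v g = 0.
Proof.
move=> nv ng n2 z2.
have e : cross n (cross v g) = dot n g *: v - dot n v *: g.
  by apply: vec3P; rewrite /cross /dot !(vec3E, mxE); ring.
rewrite nv ng !scale0r subr0 in e.
move: (cross v g) z2 e => z z2 e; have E i : cross n z 0 i = 0 by rewrite e mxE.
have := E o0; have := E o1; rewrite /cross !vec3E z2 !mulr0 sub0r subr0 => /eqP h1 /eqP h0.
apply: vec3P; rewrite [RHS]mxE //; apply/eqP.
  by move: h1; rewrite mulf_eq0 (negPf n2).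
by move: h0; rewrite oppr_eq0 mulf_eq0 (negPf n2).
Qed.

Local Notation W := ('M[K]_(2, 3) * 'M[K]_(3, 10) * 'rV[K]_10)%type.

Lemma generic_aligned (t : W) : generic t != 0 ->
  exists2 p, aligned_cubics K p & pline p = <[cubd (cubic_family t)]>%VS.
Proof.
rewrite /generic; set f := cubic_family t; set u := row ord0 _; set w := row ord_max _.
rewrite !mulf_eq0 !negb_or => /andP[/andP[/andP[D1 D2] G3] n2].
have sepr (k : 'I_3) (l : 'I_2) : separable_poly (elimp (perm_coef (lift k l) (lift k (rev_ord l)) k (cf f))).
  apply: (@disc_separable K 6); first exact: size_elimp.
  move: D1; rewrite prodf_seq_neq0 => /allP /(_ k); rewrite mem_index_enum => /(_ isT).
  by rewrite prodf_seq_neq0 => /allP /(_ l); rewrite mem_index_enum => /(_ isT).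
have sep0 : ~~ separable_poly (0 : {poly K}).
  by rewrite unlock /coprimep deriv0 gcd0p size_poly0.
have r0 (k : 'I_3) (l : 'I_2) : elimp (perm_coef (lift k l) (lift k (rev_ord l)) k (cf f)) != 0.
  by apply: contraNneq sep0 => <-.
have f0 : f != 0.
  apply: contraNneq (r0 o0 ord0) => ->.
  rewrite (_ : perm_coef _ _ _ _ = fun=> 0) ?elimp0 //.
  by apply/funext => m; rewrite /perm_coef /cf mxE.
have cf0 : cubd f != 0.
  by apply: contraNneq f0 => h; rewrite -[f]cubdK h raddf0.
have [p ep] := exists_point cf0; exists p => //.
set G := line_poly_of _ _ _ in D2 G3.
have sG : size G = 4%N.
  apply/eqP; rewrite eqn_leq size_line_poly ltnNge; apply: contra G3 => h.
  by rewrite nth_default.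
have sepG : separable_poly G by apply: (@disc_separable K 2); rewrite ?sG.
have [A eA] := closed_field_poly_normal G.
have G0 : G != 0 by rewrite -size_poly_eq0 sG.
have uA : uniq A.
  have := sepG; rewrite eA unlock derivZ coprimepZl ?coprimepZr ?lead_coef_eq0 // => h.
  by rewrite -separable_prod_XsubC unlock.
have sA : size A = 3%N.
  by move: sG; rewrite eA size_scale ?lead_coef_eq0 // size_prod_XsubC => -[].
pose n := cross u w.
have n0 : n != 0 by apply: contraNneq n2 => e; rewrite -/n e mxE.
have /cond_mx0 [q0 q1 q2] := cubic_family_cond t.
pose pt s := s *: u + w.
have ptE s : pt s = s *: u + 1 *: w by rewrite scale1r.
have rootA s : s \in A -> cross (pt s) (gradient (cf f) (pt s)) = 0.
  (* The gradient at a point of the plane is orthogonal to n by the three conditions on the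
     family. *)
  move=> sA'; apply: (@cross_orthogonal n); rewrite ?ptE ?dot_cross //.
    by rewrite -/(polar _ _ _) polar_span q0 q1 q2; ring.
  rewrite -ptE -horner_line_poly -/G eA hornerZ.
  by have /rootP -> : root (\prod_(z <- A) ('X - z%:P)) s; rewrite ?mulr0 ?root_prod_XsubC.
have pt0 s : pt s != 0.
  apply/negP => /eqP e; have := cross_lin u w s 1 1 0; rewrite -ptE e cross0v => /esym/eqP.
  by rewrite scaler_eq0 (negPf n0) mulr0 mulr1 sub0r oppr_eq0 oner_eq0.
have P s : exists2 x : proj 'rV[K]_3, pline x = <[pt s]>%VS & s \in A -> eigenpoints (cub (cf f)) x.
  have [x ex] := exists_point (pt0 s); exists x => // sA'.
  by apply/(@eigenpoint_cross _ x (pt s)); rewrite ?ex ?memv_line ?rootA.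
have inj s s' (x y : proj 'rV[K]_3) : pline x = <[pt s]>%VS -> pline y = <[pt s']>%VS -> s != s' -> x <> y.
  move=> ex ey ss' exy; have : pt s' \in pline x by rewrite exy ey memv_line.
  rewrite ex => /vlineP [b eb].
  have := cross_lin u w s 1 s' 1; rewrite -!ptE eb.
  have -> : cross (pt s) (b *: pt s) = 0.
    by apply: vec3P; rewrite /cross vec3E !mxE; ring.
  move=> /esym/eqP; rewrite scaler_eq0 (negPf n0) orbF mulr1 mul1r subr_eq0.
  by rewrite (negPf ss').
case: A {eA} uA sA rootA P => [|s1 [|s2 [|s3 [|//]]]] //= uA _ _ P.
move: uA; rewrite !inE !negb_or !andbT => /andP[/andP[s12 s13] s23].
have [x1 e1 E1] := P s1; have [x2 e2 E2] := P s2; have [x3 e3 E3] := P s3.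
have {}E1 := E1 (mem_head _ _).
have {}E2 : eigenpoints (cub (cf f)) x2 by apply: E2; rewrite !inE eqxx orbT.
have {}E3 : eigenpoints (cub (cf f)) x3 by apply: E3; rewrite !inE eqxx !orbT.
exists (cubd f); split=> //.
  by apply: regular_of_separable => //; exists x1.
exists x1, x2, x3; split=> //; split; first by split; apply: inj; eassumption.
exists (<[u]> + <[w]>)%VS; split.
- have uw : (<[u]> :&: <[w]> = 0)%VS.
    apply/eqP; rewrite -subv0; apply/subvP => z; rewrite memv_cap => /andP[/vlineP [a ->] /vlineP [b ab]].
    rewrite memv0 ab; have := cross_lin u w a 0 0 b.
    rewrite !scale0r addr0 add0r -ab mul0r subr0; have -> : cross (a *: u) (a *: u) = 0 by apply: crossvv.
    move=> /esym/eqP; rewrite scaler_eq0 (negPf n0) orbF mulf_eq0 => /orP[] /eqP h.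
      by rewrite h scale0r.
    by rewrite ab h scale0r.
  have u0 : u != 0 by apply: contraNneq n0 => h; rewrite /n h cross0v.
  have w0 : w != 0.
    by apply: contraNneq n0 => h; apply/eqP/vec3P; rewrite /n /cross h vec3E !mxE; ring.
  by have := dimv_sum_cap <[u]> <[w]>; rewrite uw dimv0 addn0 !dim_vline u0 w0.
- by rewrite e1 -memvE memv_add // ?memvZ ?memv_line.
- by rewrite e2 -memvE memv_add // ?memvZ ?memv_line.
- by rewrite e3 -memvE memv_add // ?memvZ ?memv_line.
Qed.

End Eigenpoints.

(** * The explicit cubic satisfies the genericity condition *)

Section SampleGeneric.
Variable K : numClosedFieldType.

Let f0 : 'rV[K]_10 := \row_k sample K k.
Let u0 : 'rV[K]_3 := vec3 1 (-1) 0.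
Let w0 : 'rV[K]_3 := vec3 0 (-1) 1.

Lemma cf_sample n : (n < 10)%N -> cf f0 n = sample K n.
Proof. by move=> n10; rewrite /cf mxE inordK. Qed.

Lemma cross_sample : cross u0 w0 = vec3 (-1) (-1) (-1).
Proof. by apply: vec3P; rewrite /cross !vec3E; ring. Qed.

Lemma polar_sample (v : 'rV[K]_3) : v 0 o0 + v 0 o1 + v 0 o2 = 0 -> polar (cf f0) (cross u0 w0) v = 0.
Proof.
move=> /eqP; rewrite addrC addr_eq0 => /eqP v2.
rewrite cross_sample polarE !vec3E v2 /cubic_x /cubic_y /cubic_z !cf_sample // /sample /=.
ring.
Qed.

(** Only the parity of the renaming matters, since the sample is invariant under cyclic shifts. *)
Lemma sample_perm (k : 'I_3) (l : 'I_2) :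
  let r := elimp (perm_coef (lift k l) (lift k (rev_ord l)) k (cf f0)) in
  r = elimp (sample K) \/ r = elimp (sample' K).
Proof.
have first i j m : (forall n, (n < 10)%N -> perm_coef i j m (cf f0) n = sample K n) ->
    elimp (perm_coef i j m (cf f0)) = elimp (sample K) by apply: elimp_ext.
have second i j m : (forall n, (n < 10)%N -> perm_coef i j m (cf f0) n = sample' K n) ->
    elimp (perm_coef i j m (cf f0)) = elimp (sample' K) by apply: elimp_ext.
move: l; apply: ord2P; move: k; apply: ord3P; rewrite !(rev_ord2E, lift3E) /=;
  solve [left; apply: first; do 10! [case=> [_|]; first by rewrite /perm_coef /= cf_sample]; by []
       | right; apply: second; do 10! [case=> [_|]; first by rewrite /perm_coef /= cf_sample]; by []].
Qed.

(** The point s u0 + w0 = (s, -s - 1, 1) has x/z = s, so the roots come from the three eigenpoints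
    on x + y + z = 0. *)
Lemma line_poly_sample : line_poly_of (cf f0) u0 w0 =
  - 2%:P * ((4%:P * 'X - 1%:P) * ('X + 5%:P) * (5%:P * 'X + 4%:P)).
Proof.
rewrite /line_poly_of !vec3E /cubic_x /cubic_y !cf_sample // /sample /= !(polyC_natr, polyCN, polyC1, polyC0).
ring.
Qed.

Lemma sample_generic : exists t, generic t != 0 :> K.
Proof.
have n0 : cross u0 w0 != 0.
  rewrite cross_sample; apply/eqP => /(congr1 (fun v : 'rV[K]_3 => v 0 o0)).
  by rewrite vec3E mxE => /eqP; rewrite oppr_eq0 oner_eq0.
have fM : f0 *m cond_mx u0 w0 = 0.
  by apply/cond_mx0; split; apply: polar_sample; rewrite ?mxE /=; ring.
have [t [ft et0 et1]] := cubic_family_surj n0 fM; exists t.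
rewrite /generic ft et0 et1.
have [sG sepG] : size (line_poly_of (cf f0) u0 w0) = 4%N /\ separable_poly (line_poly_of (cf f0) u0 w0).
  apply: (separable_of_roots (rs := [:: 1 / 4; -5; - (4 / 5)]) (h := ratr)).
  - apply/eqP => /(congr1 (horner^~ 0)); rewrite line_poly_sample.
    rewrite !(hornerM, hornerD, hornerN, hornerC, hornerX) => /eqP.
    by rewrite !mulr0 !sub0r !add0r !(mulf_eq0, oppr_eq0, oner_eq0, pnatr_eq0).
  - exact: size_line_poly.
  - by [].
  rewrite /= !(rmorphN, fmorph_div, ratr_nat) /root line_poly_sample.
  rewrite !(hornerM, hornerD, hornerN, hornerC, hornerX).
  by do ![apply/andP; split] => //; apply/eqP; field.
rewrite !mulf_neq0 //.
- apply/prodf_neq0 => k _; apply/prodf_neq0 => l _.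
  by have [->|->] := sample_perm k l; apply: separable_disc;
    [have [] := separable_sample K|have [] := separable_sample K
    |have [] := separable_sample' K|have [] := separable_sample' K].
- exact: separable_disc.
- have : lead_coef (line_poly_of (cf f0) u0 w0) != 0 by rewrite lead_coef_eq0 -size_poly_eq0 sG.
  by rewrite lead_coefE sG.
- by rewrite cross_sample vec3E oppr_eq0 oner_eq0.
Qed.

End SampleGeneric.

Lemma coplanar_combination (K : fieldType) (V : vectType K) (p q r : proj V) (v w x : V) :
  v \in pline p -> w \in pline q -> x \in pline r -> v != 0 -> w != 0 -> x != 0 ->
  p <> q -> p <> r -> q <> r -> collinear3 p q r ->
  exists a b, [/\ a != 0, b != 0 & x = a *: v + b *: w].
Proof.
move=> vp wq xr v0 w0 x0 pq pr qr [L [dL pL qL rL]].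
have indep (p1 p2 : proj V) v1 v2 : v1 \in pline p1 -> v2 \in pline p2 -> v1 != 0 -> v2 != 0 ->
    p1 <> p2 -> (<[v1]> :&: <[v2]> = 0)%VS.
  move=> h1 h2 n1 n2 ne; apply/eqP; rewrite -subv0; apply/subvP => z.
  rewrite memv_cap memv0 => /andP[z1 z2]; apply: contraT => z0; case: ne; apply: pline_inj.
  rewrite -(pline_line h1 n1) in z1; rewrite -(pline_line h2 n2) in z2.
  by rewrite (pline_line z1 z0) (pline_line z2 z0).
have eL : (<[v]> + <[w]> = L)%VS.
  apply/eqP; rewrite eqEdim subv_add -!memvE (subvP pL) // (subvP qL) //= dL.
  by have := dimv_sum_cap <[v]> <[w]>; rewrite (indep p q) // dimv0 addn0 !dim_vline v0 w0 => ->.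
have : x \in (<[v]> + <[w]>)%VS by rewrite eL (subvP rL).
case/memv_addP => _ /vlineP [a ->] [_ /vlineP [b ->] ex]; exists a, b; split=> //.
  apply: contra_not_neq qr => a0; apply: pline_inj; rewrite (pline_line wq w0).
  rewrite (pline_line xr x0); apply/eqP; rewrite eq_sym eqEdim !dim_vline w0 x0 -memvE ex a0 scale0r add0r.
  by rewrite memvZ ?memv_line.
apply: contra_not_neq pr => b0; apply: pline_inj; rewrite (pline_line vp v0).
rewrite (pline_line xr x0); apply/eqP; rewrite eq_sym eqEdim !dim_vline v0 x0 -memvE ex b0 scale0r addr0.
by rewrite memvZ ?memv_line.
Qed.

Lemma parallel (K : fieldType) (y z : 'rV[K]_3) : y != 0 -> cross y z = 0 ->
  exists a, z = a *: y.
Proof.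
move=> y0 yz; have E i : cross y z 0 i = 0 by rewrite yz mxE.
have := E o0; have := E o1; have := E o2; rewrite /cross !vec3E.
move=> /eqP + /eqP + /eqP; rewrite !subr_eq0 => /eqP c2 /eqP c1 /eqP c0.
have [k yk] : exists k, y 0 k != 0.
  apply/not_existsP => h; case/eqP: y0; apply/rowP => k; rewrite [RHS]mxE.
  by apply/eqP/negPn/negP; apply: h.
exists (z 0 k / y 0 k).
have key j : y 0 k * z 0 j = y 0 j * z 0 k -> z 0 j = (z 0 k / y 0 k *: y) 0 j.
  by move=> e; apply: (mulfI yk); rewrite e mxE mulrA mulrCA divff // mulr1 mulrC.
by apply: vec3P; apply: key; move: k {yk}; apply: ord3P => //.
Qed.

(** Representatives of two of the points are rescaled so that their sum represents the third. At
    each of them the gradient is a multiple of the point, hence orthogonal to the normal. *)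
Lemma aligned_of_triple (K : numClosedFieldType) (f : 'rV[K]_10) :
  aligned_triple (eigenpoints (cub (cf f))) -> aligned f.
Proof.
move=> [p [q [r [[Ep Eq Er] [[pq pr qr] col]]]]].
have [v vp v0] := pline_neq0 p; have [w wq w0] := pline_neq0 q; have [x xr x0] := pline_neq0 r.
have [a [b [a0 b0 ex]]] := coplanar_combination vp wq xr v0 w0 x0 pq pr qr col.
have polar0 n y : dot n y = 0 -> y != 0 -> cross y (gradient (cf f) y) = 0 -> polar (cf f) n y = 0.
  move=> ny y0 /(parallel y0) [d]; rewrite /polar => ->.
  by transitivity (d * dot n y); [rewrite /dot !mxE; ring|rewrite ny mulr0].
have av0 : a *: v != 0 by rewrite scaler_eq0 negb_or a0.
have bw0 : b *: w != 0 by rewrite scaler_eq0 negb_or b0.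
have n0 : cross (a *: v) (b *: w) != 0.
  apply/negP => /eqP /(parallel av0) [d e]; case: pq; apply: pline_inj.
  have ap : a *: v \in pline p by rewrite memvZ.
  have bp : b *: w \in pline p by rewrite e memvZ.
  have bq : b *: w \in pline q by rewrite memvZ.
  by rewrite (pline_line bp bw0) (pline_line bq bw0).
have eig (y : proj 'rV[K]_3) z : eigenpoints (cub (cf f)) y -> z \in pline y -> z != 0 ->
   cross z (gradient (cf f) z) = 0 by move=> Ey zy z0; apply/(eigenpoint_cross _ zy z0).
exists (a *: v), (b *: w); split=> //; split; apply: polar0 => //.
- by have := dot_cross (a *: v) (b *: w) 1 0; rewrite scale0r addr0 scale1r.
- by apply: (eig p); rewrite ?memvZ.
- by have := dot_cross (a *: v) (b *: w) 0 1; rewrite scale0r add0r scale1r.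
- by apply: (eig q); rewrite ?memvZ.
- by have := dot_cross (a *: v) (b *: w) 1 1; rewrite !scale1r.
- by rewrite -ex.
- by rewrite -ex; apply: (eig r).
Qed.

(** * The Macaulay determinant *)

Section Macaulay.
Variable S : comNzRingType.
Implicit Types (c : nat -> S) (L : nat -> nat -> nat -> S).

(* For L p q r = a^p b^q d^r these are the values of the polar of the cubic c
   along n = (a, b, d) at n x e_i and its polarisations at n x e_i, n x e_j. *)
Definition polar_cubic c L (i : nat) : S := nth 0 [::
  c 3%N * L 1%N 0%N 2%N + c 4%N * L 1%N 2%N 0%N + c 5%N * L 0%N 1%N 2%N *+ 3 - c 6%N * L 0%N 2%N 1%N *+ 2 + c 6%N * L 0%N 0%N 3%N
    + c 7%N * L 0%N 3%N 0%N - c 7%N * L 0%N 1%N 2%N *+ 2 + c 8%N * L 0%N 2%N 1%N *+ 3 - c 9%N * L 1%N 1%N 1%N;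
  - (c 1%N * L 1%N 0%N 2%N *+ 2) + c 2%N * L 1%N 1%N 1%N *+ 2 - c 3%N * L 0%N 1%N 2%N *+ 2 - c 4%N * L 2%N 1%N 0%N *+ 2
    + c 4%N * L 0%N 1%N 2%N *+ 2 + c 6%N * L 1%N 1%N 1%N *+ 2 - c 7%N * L 1%N 2%N 0%N *+ 2 + c 7%N * L 1%N 0%N 2%N *+ 2
    - c 8%N * L 1%N 1%N 1%N *+ 6 + c 9%N * L 2%N 0%N 1%N + c 9%N * L 0%N 2%N 1%N - c 9%N * L 0%N 0%N 3%N;
  c 1%N * L 1%N 1%N 1%N *+ 2 - c 2%N * L 1%N 2%N 0%N *+ 2 - c 3%N * L 2%N 0%N 1%N *+ 2 + c 3%N * L 0%N 2%N 1%N *+ 2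
    - c 4%N * L 0%N 2%N 1%N *+ 2 - c 5%N * L 1%N 1%N 1%N *+ 6 + c 6%N * L 1%N 2%N 0%N *+ 2 - c 6%N * L 1%N 0%N 2%N *+ 2
    + c 7%N * L 1%N 1%N 1%N *+ 2 + c 9%N * L 2%N 1%N 0%N - c 9%N * L 0%N 3%N 0%N + c 9%N * L 0%N 1%N 2%N;
  c 0%N * L 1%N 0%N 2%N *+ 3 + c 1%N * L 0%N 1%N 2%N - c 2%N * L 2%N 0%N 1%N *+ 2 + c 2%N * L 0%N 0%N 3%N + c 4%N * L 3%N 0%N 0%N
    - c 4%N * L 1%N 0%N 2%N *+ 2 + c 7%N * L 2%N 1%N 0%N + c 8%N * L 2%N 0%N 1%N *+ 3 - c 9%N * L 1%N 1%N 1%N;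
  - (c 0%N * L 1%N 1%N 1%N *+ 6) + c 1%N * L 2%N 0%N 1%N *+ 2 - c 1%N * L 0%N 2%N 1%N *+ 2 + c 2%N * L 2%N 1%N 0%N *+ 2
    - c 2%N * L 0%N 1%N 2%N *+ 2 + c 3%N * L 1%N 1%N 1%N *+ 2 + c 4%N * L 1%N 1%N 1%N *+ 2 - c 6%N * L 2%N 1%N 0%N *+ 2
    - c 7%N * L 2%N 0%N 1%N *+ 2 - c 9%N * L 3%N 0%N 0%N + c 9%N * L 1%N 2%N 0%N + c 9%N * L 1%N 0%N 2%N;
  c 0%N * L 1%N 2%N 0%N *+ 3 - c 1%N * L 2%N 1%N 0%N *+ 2 + c 1%N * L 0%N 3%N 0%N + c 2%N * L 0%N 2%N 1%N + c 3%N * L 3%N 0%N 0%N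
    - c 3%N * L 1%N 2%N 0%N *+ 2 + c 5%N * L 2%N 1%N 0%N *+ 3 + c 6%N * L 2%N 0%N 1%N - c 9%N * L 1%N 1%N 1%N] i.

(** Corresponds to multiplying a form in n by its k-th coordinate. *)
Definition shift (T : Type) (k : nat) (L : nat -> nat -> nat -> T) (p q r : nat) : T :=
  L (p + (k == 0))%N (q + (k == 1))%N (r + (k == 2))%N.

Lemma polar_cubic_ext c L L' i :
  (forall p q r, (p + q + r)%N = 3 -> L p q r = L' p q r) -> polar_cubic c L i = polar_cubic c L' i.
Proof. by move=> e; rewrite /polar_cubic !e. Qed.

Lemma polar_cubicD c L L' i :
  polar_cubic c (fun p q r => L p q r + L' p q r) i = polar_cubic c L i + polar_cubic c L' i.
Proof.
rewrite /polar_cubic; move: i => [|[|[|[|[|[|i]]]]]]; rewrite /= ?nth_nil ?addr0 //; ring.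
Qed.

Lemma polar_cubicZ c L (a : S) i :
  polar_cubic c (fun p q r => L p q r * a) i = polar_cubic c L i * a.
Proof.
rewrite /polar_cubic; move: i => [|[|[|[|[|[|i]]]]]]; rewrite /= ?nth_nil ?mul0r //; ring.
Qed.

Lemma polar_cubic0 c i : polar_cubic c (fun _ _ _ => 0) i = 0.
Proof. by have := polar_cubicZ c (fun _ _ _ => 0) 0 i; rewrite !mulr0. Qed.

Lemma polar_cubic_sum c n (L : 'I_n -> nat -> nat -> nat -> S) i :
  polar_cubic c (fun p q r => \sum_(m < n) L m p q r) i = \sum_(m < n) polar_cubic c (L m) i.
Proof.
elim: n L => [|n IH] L.
  by rewrite big_ord0 (_ : (fun p q r => _) = fun _ _ _ => 0) ?polar_cubic0 //;
    apply/funext => p; apply/funext => q; apply/funext => r; rewrite big_ord0.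
rewrite [RHS]big_ord_recr /= -IH -polar_cubicD; congr polar_cubic.
by apply/funext => p; apply/funext => q; apply/funext => r; rewrite big_ord_recr.
Qed.

Definition quartic_exponents : seq (nat * nat * nat) :=
  [:: (4, 0, 0); (3, 1, 0); (3, 0, 1); (2, 2, 0); (2, 1, 1); (2, 0, 2); (1, 3, 0); (1, 2, 1);
      (1, 1, 2); (1, 0, 3); (0, 4, 0); (0, 3, 1); (0, 2, 2); (0, 1, 3); (0, 0, 4)]%N.

(* Fifteen of the eighteen products of the six polar cubics with a coordinate
   of n; the other three depend on them. *)
Definition macaulay_rows : seq (nat * nat) :=
  [:: (0, 0); (0, 1); (0, 2); (1, 1); (1, 2); (2, 1); (3, 0); (3, 1); (3, 2);
      (4, 0); (4, 1); (4, 2); (5, 0); (5, 1); (5, 2)]%N.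

(** Taking for [L] the indicator of the m-th quartic monomial extracts its coefficient in the i-th
    product. *)
Definition macaulay_entry c (i m : nat) : S :=
  let ik := nth (0, 0)%N macaulay_rows i in
  polar_cubic c (shift ik.2 (fun p q r => ((p, q, r) == nth (0, 0, 0)%N quartic_exponents m)%:R)) ik.1.

Definition macaulay c : 'M[S]_15 := \matrix_(i, m) macaulay_entry c i m.

Definition monomial_values (x : 'cV[S]_15) (p q r : nat) : S :=
  \sum_(m < 15) ((p, q, r) == nth (0, 0, 0)%N quartic_exponents m)%:R * x m 0.

Lemma macaulay_mul c (x : 'cV[S]_15) i :
  (macaulay c *m x) i 0 = let ik := nth (0, 0)%N macaulay_rows i in
  polar_cubic c (shift ik.2 (monomial_values x)) ik.1.
Proof.
rewrite mxE /=; under eq_bigr do rewrite mxE /macaulay_entry -polar_cubicZ.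
by rewrite -polar_cubic_sum.
Qed.

Lemma monomial_valuesE x (m : 'I_15) p q r : (p, q, r) = nth (0, 0, 0)%N quartic_exponents m ->
  monomial_values x p q r = x m 0.
Proof.
rewrite /monomial_values => ->; rewrite (bigD1 m) //= eqxx mul1r big1 ?addr0 // => j jm.
by rewrite nth_uniq // eq_sym (negPf (jm : val j != val m)) mul0r.
Qed.

Lemma quartic_exponents_cover p q r : (p + q + r)%N = 4 ->
  exists m : 'I_15, (p, q, r) = nth (0, 0, 0)%N quartic_exponents m.
Proof.
move=> e; have {e} : (p, q, r) \in quartic_exponents.
  by move: e; case: p => [|[|[|[|[|p]]]]]; case: q => [|[|[|[|[|q]]]]];
    case: r => [|[|[|[|[|r]]]]]; rewrite ?addnS ?addSn.
by move=> /(nthP (0, 0, 0)%N) [m m15 <-]; exists (Ordinal m15).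
Qed.

End Macaulay.

Section MacaulayPolar.
Variable K : numClosedFieldType.

Lemma polar_cubicE (c : nat -> K) (n : 'rV[K]_3) i (k : nat) :
  (forall e, polar c n (cross n e) = 0) ->
  polar_cubic c (shift k (fun p q r => n 0 o0 ^+ p * n 0 o1 ^+ q * n 0 o2 ^+ r)) i = 0.
Proof.
move=> h; pose e0 : 'rV[K]_3 := vec3 1 0 0; pose e1 : 'rV[K]_3 := vec3 0 1 0.
pose e2 : 'rV[K]_3 := vec3 0 0 1; pose x := n 0 o0 ^+ (k == 0)%N * n 0 o1 ^+ (k == 1)%N * n 0 o2 ^+ (k == 2).
have -> : shift k (fun p q r => n 0 o0 ^+ p * n 0 o1 ^+ q * n 0 o2 ^+ r) =
    fun p q r => n 0 o0 ^+ p * n 0 o1 ^+ q * n 0 o2 ^+ r * x.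
  by apply/funext => p; apply/funext => q; apply/funext => r; rewrite /shift /x !exprD; ring.
rewrite polar_cubicZ; apply/eqP; rewrite mulf_eq0; apply/orP; left; apply/eqP.
have E e : polar c n (cross n e) = 0 := h e.
have -> : polar_cubic c (fun p q r => n 0 o0 ^+ p * n 0 o1 ^+ q * n 0 o2 ^+ r) i =
  nth 0 [:: polar c n (cross n e0);
    polar c n (cross n (e0 + e1)) - polar c n (cross n e0) - polar c n (cross n e1);
    polar c n (cross n (e0 + e2)) - polar c n (cross n e0) - polar c n (cross n e2);
    polar c n (cross n e1);
    polar c n (cross n (e1 + e2)) - polar c n (cross n e1) - polar c n (cross n e2);
    polar c n (cross n e2)] i.
  move: i => [|[|[|[|[|[|i]]]]]]; rewrite /polar_cubic /= ?nth_nil //;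
    rewrite !polarE /cubic_x /cubic_y /cubic_z /cross !vec3E ?mxE /=; ring.
by rewrite !E !subr0; move: i => [|[|[|[|[|[|i]]]]]] //=; rewrite nth_nil.
Qed.

(** Every n x e lies in the plane orthogonal to n, where the polar vanishes; so the quartic
    monomials in n form a vector in the kernel. It is nonzero, as it contains the fourth powers of
    the coordinates. *)
Lemma aligned_macaulay (f : 'rV[K]_10) : aligned f -> \det (macaulay (cf f)) = 0.
Proof.
move=> [u [w [n0 [h0 h1 h2]]]]; set n := cross u w in n0 h0 h1 h2.
have h e : polar (cf f) n (cross n e) = 0.
  have -> : cross n e = (- dot w e) *: u + dot u e *: w.
    by apply: vec3P; rewrite /n /cross /dot !(vec3E, mxE); ring.
  by rewrite polar_span h0 h1 h2; ring.
pose x : 'cV[K]_15 := \col_m (let e := nth (0, 0, 0)%N quartic_exponents m in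
  n 0 o0 ^+ e.1.1 * n 0 o1 ^+ e.1.2 * n 0 o2 ^+ e.2).
have xE p q r : (p + q + r)%N = 4 -> monomial_values x p q r = n 0 o0 ^+ p * n 0 o1 ^+ q * n 0 o2 ^+ r.
  by move=> /quartic_exponents_cover [m em]; rewrite (monomial_valuesE x em) mxE -em.
apply/eqP; rewrite -det_tr; apply/det0P; exists x^T.
  apply/eqP => /(congr1 trmx); rewrite trmxK trmx0 => x0.
  have z (a : K) : a ^+ 4 = 0 -> a = 0 by move/eqP; rewrite expf_eq0 => /eqP.
  case/eqP: n0; apply: vec3P; rewrite [RHS]mxE; apply: z.
  - by have := xE 4 0 0 erefl; rewrite x0 /monomial_values big1 ?expr0 ?mulr1 => [->|m _] //; rewrite mxE mulr0.
  - by have := xE 0 4 0 erefl; rewrite x0 /monomial_values big1 ?expr0 ?mulr1 ?mul1r => [->|m _] //; rewrite mxE mulr0.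
  - by have := xE 0 0 4 erefl; rewrite x0 /monomial_values big1 ?expr0 ?mulr1 ?mul1r => [->|m _] //; rewrite mxE mulr0.
rewrite -trmx_mul; apply: trmx_inj; rewrite trmxK trmx0; apply/colP => i.
rewrite macaulay_mul [RHS]mxE /=; set ik := nth _ _ _.
rewrite -(polar_cubicE ik.1 ik.2 h); apply: polar_cubic_ext => p q r e; rewrite /shift xE //.
have : (ik.2 < 3)%N by rewrite /ik; case: i {ik} => -[|[|[|[|[|[|[|[|[|[|[|[|[|[|[|]]]]]]]]]]]]]]].
by rewrite (addnACA p) (addnACA (p + q)%N) e; case: ik.2 => [|[|[|]]].
Qed.

(* Coefficients of x^3 + xyz + 2 y^3. *)
Definition base_dir (i : 'I_9) : K := nth 0 [:: 1; 0; 0; 0; 0; 2] i.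

Lemma dir_base_dir j : (j < 10)%N ->
  dir base_dir (inord j) = nth 0 [:: 1; 0; 0; 0; 0; 2; 0; 0; 0; 1] j.
Proof.
move=> j10; rewrite /dir; case: unliftP => [l|] /(congr1 val) /=; rewrite inordK // => ->; last by [].
have l9 := ltn_ord l; rewrite /bump leqNgt l9 /base_dir.
by case: l l9 => -[|[|[|[|[|[|[|[|[|]]]]]]]]].
Qed.

Lemma lin_eq (a b k e : K) : e = 0 -> a - b = k * e -> a = b.
Proof. by move=> -> h; apply/eqP; rewrite -subr_eq0 h mulr0. Qed.

Ltac row R cE i k := move: (R i isT); rewrite /= /polar_cubic /shift /= !cE //= !(addn0, add0n, addn1);
  move=> /(lin_eq (k := k)); apply.

(** Coefficient 1 at y^3 would make the determinant zero: a cubic symmetric in x and y has gradient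
    orthogonal to (1, -1, 0) on the plane x = y, so it lies in X. *)
Lemma macaulay_base : \det (macaulay (cf (\row_i dir base_dir i : 'rV[K]_10))) != 0.
Proof.
set c := cf _.
have cE j : (j < 10)%N -> c j = nth 0 [:: 1; 0; 0; 0; 0; 2; 0; 0; 0; 1] j.
  by move=> j10; rewrite /c /cf mxE dir_base_dir.
apply/negP; rewrite -det_tr => /det0P [y y0 ey].
have {ey} ex : macaulay c *m y^T = 0 by apply: trmx_inj; rewrite trmx_mul trmxK ey trmx0.
pose L := monomial_values y^T.
have R i : (i < 15)%N -> let ik := nth (0, 0)%N macaulay_rows i in polar_cubic c (shift ik.2 L) ik.1 = 0.
  by move=> i15; have := macaulay_mul c y^T (Ordinal i15); rewrite ex mxE => /esym.
(* Elimination by hand on a kernel vector: in [row R cE i k] the i-th equation times [k] is the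
   difference of the two sides, modulo the relations already found. *)
have E0 : L 2 1 1 = L 1 1 2 *+ 6.
  by row R cE 0%N (-1 : K); ring.
have E1 : L 1 2 1 = L 1 1 2 *+ 3.
  by row R cE 7%N (-1 : K); ring.
have E2 : L 1 1 2 = 0.
  by row R cE 14%N (44^-1 : K); rewrite E0 E1; field; rewrite ?pnatr_eq0.
rewrite E2 mul0rn in E0; rewrite E2 mul0rn in E1.
have E3 : L 0 2 2 = 0 by row R cE 1%N (6^-1 : K); rewrite E1; field; rewrite ?pnatr_eq0.
have E4 : L 0 1 3 = 0 by row R cE 2%N (6^-1 : K); rewrite E2; field; rewrite ?pnatr_eq0.
have E5 : L 1 0 3 = 0 by row R cE 8%N (3^-1 : K); rewrite E2; field; rewrite ?pnatr_eq0.
have E6 : L 0 3 1 = 0 by row R cE 3%N (1 : K); rewrite E0 E4; ring.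
have E7 : L 2 0 2 = 0 by row R cE 6%N (3^-1 : K); rewrite E0; field; rewrite ?pnatr_eq0.
have E8 : L 0 0 4 = 0 by row R cE 4%N (-1 : K); rewrite E3 E7; ring.
have E9 : L 3 0 1 = 0 by row R cE 11%N (-1 : K); rewrite E1 E2 E5; ring.
have E10 : L 1 3 0 = L 3 1 0 by row R cE 10%N (1 : K); rewrite E1 E2; ring.
have E11 : L 3 1 0 = L 2 2 0 *- 2 by row R cE 13%N (3^-1 : K); rewrite E1 E10; field; rewrite ?pnatr_eq0.
have E12 : L 2 2 0 = 0.
  by row R cE 12%N (- 9^-1 : K); rewrite E0 E11; field; rewrite ?oppr_eq0 ?pnatr_eq0.
rewrite E12 mul0rn oppr0 in E11; rewrite E11 in E10.
have E13 : L 0 4 0 = 0 by row R cE 5%N (-1 : K); rewrite E1 E3 E12; ring.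
have E14 : L 4 0 0 = 0 by row R cE 9%N (-1 : K); rewrite E0 E7 E12; ring.
case/eqP: y0; apply/rowP => m; rewrite [RHS]mxE.
have -> : y 0 m = (let e := nth (0, 0, 0)%N quartic_exponents m in L e.1.1 e.1.2 e.2).
  by rewrite /L (@monomial_valuesE _ _ m) ?mxE // -!surjective_pairing.
by case: m => -[|[|[|[|[|[|[|[|[|[|[|[|[|[|[|]]]]]]]]]]]]]]].
Qed.

End MacaulayPolar.

Lemma det_homog (R : comNzRingType) n m (A : 'M[{mpoly R[n]}]_m) :
  (forall i j, A i j \is 1.-homog) -> \det A \is m.-homog.
Proof.
move=> hA; apply: rpred_sum => s _; rewrite rpredMsign.
have h (F : 'I_m -> {mpoly R[n]}) r : (forall i, F i \is 1.-homog) -> \prod_(i <- r) F i \is (size r).-homog.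
  move=> hF; elim: r => [|i r IH]; rewrite ?big_nil ?dhomog1 // big_cons /= -add1n.
  exact: dhomogM.
have := h _ (enum 'I_m) (fun i => hA i (s i)); by rewrite size_enum_ord big_enum.
Qed.

Section MacaulayForm.
Variable K : numClosedFieldType.

Lemma rmorph_polar_cubic (S T : comNzRingType) (f : {rmorphism S -> T}) c L i :
  f (polar_cubic c L i) = polar_cubic (f \o c) (fun p q r => f (L p q r)) i.
Proof.
rewrite /polar_cubic; case: i => [|[|[|[|[|[|i]]]]]];
  rewrite /= ?nth_nil ?rmorph0 // !(rmorphD, rmorphB, rmorphMn, rmorphN, rmorphM) //.
Qed.

Definition macaulay_form : {mpoly K[10]} := \det (macaulay (fun n => 'X_(inord n))).

Lemma meval_macaulay_form x : macaulay_form.@[x] = \det (macaulay (cf (\row_i x i))).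
Proof.
rewrite /macaulay_form -[LHS]det_map_mx; congr determinant; apply/matrixP => i j; rewrite !mxE.
rewrite /macaulay_entry [LHS]rmorph_polar_cubic; set ik := nth _ _ _.
have -> : [eta meval x] \o (fun n : nat => 'X_(inord n)) = cf (\row_i x i).
  by apply/funext => n; rewrite /= mevalXU /cf mxE.
by apply: polar_cubic_ext => p q r _; rewrite /shift /= rmorph_nat.
Qed.

Lemma macaulay_form_homog : macaulay_form \is 15.-homog.
Proof.
apply: det_homog => i j; rewrite mxE /macaulay_entry; set ik := nth _ _ _.
have h n (b : bool) : 'X_(inord n) * (b%:R : {mpoly K[10]}) \is 1.-homog.
  by case: b; rewrite ?mulr0 ?rpred0 // mulr1 dhomogX /= mdeg1.
rewrite /polar_cubic /shift; case: ik.1 => [|[|[|[|[|[|l]]]]]]; rewrite /= ?nth_nil ?rpred0 //;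
  repeat first [apply: h | apply: rpredD | apply: rpredB | apply: rpredMn | rewrite rpredN].
Qed.
End MacaulayForm.

(** * Tangent vectors *)

(* If the hypersurface H = 0 contains through x0 curves with every tangent
   vector, the lowest homogeneous part of H at x0 vanishes everywhere. *)
Lemma tangent_cone (K : numFieldType) n (H : {mpoly K[n]}) (x0 : 'I_n -> K) :
  (forall v, exists R : K^o -> 'I_n -> K, (forall i, lpoly (fun e => R e i)) /\
     forall e : K, H.@[fun i => x0 i + e * v i + e ^+ 2 * R e i] = 0) -> H = 0.
Proof.
move=> curve; pose H1 := H \mPo [tuple 'X_i + (x0 i)%:MP_[n] | i < n].
have H1E y : H1.@[y] = H.@[fun i => x0 i + y i].
  by rewrite comp_mpoly_meval; apply: meval_eq => i; rewrite tnth_mktuple mevalD mevalXU mevalC addrC.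
suff H10 : H1 = 0.
  apply: mpoly_eq0_eval => x; have := H1E (fun i => x i - x0 i); rewrite H10 meval0 => ->.
  by apply: meval_eq => i; ring.
have low k : pihomog mdeg k H1 = 0.
  elim/ltn_ind: k => k IH; apply: mpoly_eq0_eval => v; have [R [hR RH]] := curve v.
  pose s := (maxn (msize H1) k).+1.
  have ps : H1 = \sum_(j < s) pihomog mdeg j H1.
    exact: pihomog_partitionE (leq_trans (leq_maxl _ k) (leqnSn _)).
  (* For nonzero e this is H1(e v + e^2 R) / e^k; the truncation of j - k is harmless because the
     parts of degree below k vanish. At e = 0 it is the value of the k-th part at v. *)
  pose g (e : K^o) := \sum_(j < s) e ^+ (j - k) * (pihomog mdeg j H1).@[fun i => v i + e * R e i].
  have le : lpoly (fun e : K^o => e : K) by apply: lpoly_linear.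
  have gl : lpoly g.
    apply: lpoly_sum => j; apply: lpolyM; first exact: lpolyX.
    by apply: lpoly_meval => i; line_poly.
  have g0 : forall e, g e = 0.
    apply: (lpoly_dense (D := fun e : K^o => e) (w0 := 1)) => //; first exact: oner_neq0.
    move=> e e0; apply/eqP; rewrite -(mulrI_eq0 _ (mulfI (expf_neq0 k e0))) mulr_sumr; apply/eqP.
    transitivity (H1.@[fun i => e * (v i + e * R e i)]); last first.
      by rewrite -(RH e) H1E; apply: meval_eq => i; ring.
    rewrite [in RHS]ps (raddf_sum (meval _)); apply: eq_bigr => j _ /=.
    rewrite (meval_dhomog _ _ (pihomogP mdeg j H1)) mulrA -exprD.
    have [jk|kj] := ltnP j k; first by rewrite IH // meval0 !mulr0.
    by rewrite subnKC.
  have ks : (k < s)%N by rewrite ltnS leq_maxr.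
  rewrite -[RHS](g0 0) /g (bigD1 (Ordinal ks)) //= subnn expr0 mul1r big1 ?addr0 => [|j jk].
    by apply: meval_eq => i; rewrite mul0r addr0.
  have {}jk : j != k :> nat by [].
  case: (ltngtP j k) jk => // kj _; first by rewrite IH // meval0 mulr0.
  by rewrite expr0n subn_eq0 leqNgt kj mul0r.
rewrite (pihomog_partitionE (mf := mdeg) (leqnn (msize H1))) big1 // => j _; exact: low.
Qed.

Section Chart.
Variable K : numClosedFieldType.

(* With X = x - a z and Y = y - b z this is
   C(X, Y) + z q(X, Y) + N z^2 (m0 X + m1 Y) + N^2 k z^3, where q is such that the
   derivative along (a, b, 1) vanishes on the plane N z = - (a X + b Y) orthogonal
   to this vector. *)
Definition chart (a b C0 C1 C3 C5 m0 m1 k : K) (i : nat) : K :=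
  let q0 := a * m0 *+ 2 - k * a ^+ 2 *+ 3 in
  let q1 := (a * m1 + b * m0) *+ 2 - k * a * b *+ 6 in
  let q2 := b * m1 *+ 2 - k * b ^+ 2 *+ 3 in
  let N := 1 + a ^+ 2 + b ^+ 2 in
  nth 0 [:: C0; C1; - (a * C0) *+ 3 - b * C1 + q0; C3;
    a ^+ 2 * C0 *+ 3 + a * b * C1 *+ 2 + b ^+ 2 * C3 - a * q0 *+ 2 - b * q1 + N * m0;
    C5; - (a * C3) - b * C5 *+ 3 + q2;
    a ^+ 2 * C1 + a * b * C3 *+ 2 + b ^+ 2 * C5 *+ 3 - a * q1 - b * q2 *+ 2 + N * m1;
    - (a ^+ 3 * C0) - a ^+ 2 * b * C1 - a * b ^+ 2 * C3 - b ^+ 3 * C5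
      + a ^+ 2 * q0 + a * b * q1 + b ^+ 2 * q2 - N * (m0 * a + m1 * b) + N ^+ 2 * k;
    - (a * C1) *+ 2 - b * C3 *+ 2 + q1] i.

Lemma cf_row (c : nat -> K) i : (i < 10)%N -> cf (\row_(j < 10) c j) i = c i.
Proof. by move=> hi; rewrite /cf mxE inordK. Qed.

Lemma chart_aligned a b C0 C1 C3 C5 m0 m1 k :
  aligned (\row_(i < 10) chart a b C0 C1 C3 C5 m0 m1 k i).
Proof.
exists (vec3 1 0 (- a)), (vec3 0 1 (- b)); split.
  apply/eqP => /rowP /(_ o2) /eqP; rewrite /cross !vec3E mxE.
  by rewrite mul0r subr0 mulr1 oner_eq0.
by split; rewrite polarE /cubic_x /cubic_y /cubic_z !cf_row // /chart /=
  /cross !vec3E ?mxE /= ?vec3E; ring.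
Qed.

(** At x^3 + y^3 the nine coefficients of [chart] other than that of xyz are independent to first
    order, and that of xyz has no first order term. Subtracting v_9 times the direction from v
    removes its xyz coefficient; R is the rest of the curve divided by e^2. *)
Lemma chart_curve (v : 'I_10 -> K) : exists R : K^o -> 'I_10 -> K,
  (forall i, lpoly (fun e => R e i)) /\
  forall e : K, aligned (\row_i (nth 0 [:: 1; 0; 0; 0; 0; 1] i + e * v i + e ^+ 2 * R e i
                               - e * v (inord 9) * dir (@base_dir K) i)).
Proof.
pose V i := v (inord i).
(* To first order the coefficients of x^2 z and y^2 z are -3a and -3b; the shifts in [c0] and [c5]
   undo the terms x^3 and 2 y^3 of the direction. *)
pose A := - V 2 / 3; pose B := - V 6 / 3; pose c0 := V 0%N - V 9; pose c5 := V 5 - V 9 *+ 2.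
have A3 : V 2 = - A *+ 3 by rewrite /A; field; rewrite ?pnatr_eq0.
have B3 : V 6 = - B *+ 3 by rewrite /B; field; rewrite ?pnatr_eq0.
pose M := A ^+ 2 + B ^+ 2.
pose q0 (e : K) := A * V 4 *+ 2 - e * (A ^+ 2 * V 8) *+ 3.
pose q1 (e : K) := (A * V 7 + B * V 4) *+ 2 - e * (A * B * V 8) *+ 6.
pose q2 (e : K) := B * V 7 *+ 2 - e * (B ^+ 2 * V 8) *+ 3.
pose R (e : K^o) (i : 'I_10) : K := nth 0 [:: 0; 0;
  - (A * c0) *+ 3 - B * V 1%N + q0 e; 0;
  A ^+ 2 * (1 + e * c0) *+ 3 + e * (A * B * V 1%N *+ 2 + B ^+ 2 * V 3)
    - e * (A * q0 e) *+ 2 - e * (B * q1 e) + e * (M * V 4); 0;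
  - (A * V 3) - B * c5 *+ 3 + q2 e;
  e * (A ^+ 2 * V 1%N + A * B * V 3 *+ 2) + B ^+ 2 * (1 + e * c5) *+ 3
    - e * (A * q1 e) - e * (B * q2 e) *+ 2 + e * (M * V 7);
  - (e * (A ^+ 3 * (1 + e * c0))) - e ^+ 2 * (A ^+ 2 * B * V 1%N + A * B ^+ 2 * V 3)
    - e * (B ^+ 3 * (1 + e * c5)) + e ^+ 2 * (A ^+ 2 * q0 e + A * B * q1 e + B ^+ 2 * q2 e)
    - (1 + e ^+ 2 * M) * (V 4 * A + V 7 * B) + (M *+ 2 + e ^+ 2 * M ^+ 2) * (e * V 8);
  - (A * V 1%N) *+ 2 - B * V 3 *+ 2 + q1 e] i.
exists R; split=> [i|e].
  have le : lpoly (fun e : K^o => e : K) by apply: lpoly_linear.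
  by case: i => -[|[|[|[|[|[|[|[|[|[|i]]]]]]]]]] hi //; rewrite /R /q0 /q1 /q2 /=; line_poly.
rewrite (_ : \row_i _ = \row_i chart (A * e) (B * e) (1 + c0 * e) (V 1%N * e) (V 3 * e) (1 + c5 * e)
  (V 4 * e) (V 7 * e) (V 8 * e) i); first exact: chart_aligned.
apply/rowP => i; rewrite !mxE -(inord_val i).
case: i => -[|[|[|[|[|[|[|[|[|[|i]]]]]]]]]] hi //; rewrite dir_base_dir // /R /q0 /q1 /q2 /chart !inordK //= -!/(V _).
all: rewrite ?A3 ?B3 /c0 /c5 /M; ring.
Qed.

End Chart.

(** * The closure *)

Section Generator.
Variable K : numClosedFieldType.
Implicit Types (f : 'rV[K]_10) (H G : {mpoly K[10]}).

Lemma alignedZ a f : aligned f -> aligned (a *: f).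
Proof.
move=> [u [w [n0 [h0 h1 h2]]]]; exists u, w; split=> //.
have pZ n v : polar (cf (a *: f)) n v = a * polar (cf f) n v.
  by rewrite !polarE /cubic_x /cubic_y /cubic_z /cf !mxE; ring.
by split; rewrite pZ ?h0 ?h1 ?h2 mulr0.
Qed.

Definition vanish_aligned H := forall f, aligned f -> H.@[f 0] = 0.

Lemma vanish_alignedE H : vanish_aligned H <-> forall t, H.@[cubic_family t 0] = 0.
Proof.
split=> [h t|h f [u [w [n0 /cond_mx0 e]]]]; first exact/h/cubic_family_aligned.
by have [t [<- _ _]] := cubic_family_surj n0 e.
Qed.

Lemma vanish_aligned_prime G H : vanish_aligned (G * H) -> vanish_aligned G \/ vanish_aligned H.
Proof.
rewrite !vanish_alignedE => h.
apply: lpoly_mul_eq0 => [||t]; [apply/lpoly_meval/lpoly_family..|].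
by rewrite -mevalM h.
Qed.

(** Invariance puts back the multiple of the direction subtracted in [chart_curve], so that every
    tangent vector is available for [tangent_cone]. *)
Lemma vanish_aligned_invariant H : vanish_aligned H ->
  (forall x t, H.@[fun i => x i + t * dir (@base_dir K) i] = H.@[x]) -> H = 0.
Proof.
move=> Hal inv; apply: (tangent_cone (x0 := fun i => nth 0 [:: 1; 0; 0; 0; 0; 1] i)) => v.
have [R [lR al]] := chart_curve v; exists R; split=> // e.
rewrite -(inv _ (- (e * v (inord 9)))); have h := Hal _ (al e); rewrite -[RHS]h.
by apply: meval_eq => i; rewrite mxE mulNr.
Qed.

Lemma vanish_aligned_generator : exists e M, [/\ (0 < e)%N, M != 0, M \is e.-homog,
  vanish_aligned M & forall H, vanish_aligned H -> exists Q, H = Q * M].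
Proof.
have rowE f : \row_i f 0 i = f by apply/rowP => i; rewrite mxE.
pose X (x : 'I_10 -> K) := aligned (\row_i x i).
have XE H : (forall x, X x -> H.@[x] = 0) <-> vanish_aligned H.
  split=> h f; first by rewrite -{1}[f]rowE => /h.
  by move=> /h <-; apply: meval_eq => i; rewrite mxE.
have [] := @hypersurface_generator K 8 X (macaulay_form K) 15 (@base_dir K).
- by exists (cubic_family 0 0); rewrite /X rowE; apply: cubic_family_aligned.
- move=> a x /(alignedZ a); rewrite /X (_ : a *: _ = \row_i (a * x i)) //.
  by apply/rowP => i; rewrite !mxE.
- by move=> G H /XE /vanish_aligned_prime [] h; [left|right]; apply/XE.
- by move=> x Xx; rewrite meval_macaulay_form aligned_macaulay.
- exact: macaulay_form_homog.
- by rewrite meval_macaulay_form macaulay_base.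
- by move=> H /XE; apply: vanish_aligned_invariant.
move=> e [M [e0 M0 hM /XE JM gM]]; exists e, M; split=> // H /XE; exact: gM.
Qed.

End Generator.

Section Closure.
Variable K : numClosedFieldType.
Implicit Types (F : {mpoly K[\dim {: dhomog 3 K 3}]}) (H : {mpoly K[10]}).

Lemma aligned_cubics_aligned p f : aligned_cubics K p -> f \in pline p -> aligned (coefs f).
Proof.
move=> [g [g0 -> _ ht]] /vlineP [a ->]; rewrite linearZ; apply/alignedZ/aligned_of_triple.
by rewrite (_ : cub _ = g) // -[in RHS](coefsK g).
Qed.

Lemma vanish_aligned_cubics H :
  (forall p, aligned_cubics K p -> forall f, f \in pline p -> H.@[coefs f 0] = 0) -> vanish_aligned H.
Proof.
move=> h; apply/vanish_alignedE; have [t0 g0] := sample_generic K.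
apply: (lpoly_dense (g := fun t => H.@[cubic_family t 0]) (@lpoly_generic K) g0); first exact/lpoly_meval/lpoly_family.
move=> t /generic_aligned [p ap ep].
by have := h p ap (cubd (cubic_family t)); rewrite ep memv_line cubdK; apply.
Qed.

(** A form vanishing on the aligned cubics vanishes on X by density, so it is a multiple of [M] and
    vanishes wherever [F], which is [M] in the other coordinates, does. *)
Lemma aligned_cubics_closure :
  zirreducible (zclosure (aligned_cubics K)) /\ hypersurface (zclosure (aligned_cubics K)).
Proof.
have [e [M [e0 M0 hM JM gM]]] := vanish_aligned_generator K.
have [F [hF FM]] := mpoly_coord hM.
have FA p : aligned_cubics K p -> zvanish F p.
  by move=> ap f fp; rewrite FM; apply/JM/aligned_cubics_aligned/fp.
have FZ G H p : (forall f, H.@[coefs f 0] = G.@[fun i => coord (vbasis {: dhomog 3 K 3}) i f]) ->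
    vanish_aligned H -> zvanish F p -> zvanish G p.
  move=> GH /gM [Q eQ] Fp f fp; rewrite -GH eQ mevalM -FM Fp ?mulr0 //.
have ZE : zclosure (aligned_cubics K) = [set p | zvanish F p].
  apply/seteqP; split=> [|p Fp Z [[S [hS ->]] AZ] G SG].
    apply: smallest_sub => //; exists [set F]; split=> [G ->|]; first by exists e.
    by apply/seteqP; split=> p /= h; [move=> _ ->|apply: h].
  have [H GH] := coord_mpoly G; apply: (FZ _ _ _ GH) => //.
  apply: vanish_aligned_cubics => q aq f fq; rewrite GH; exact: (AZ q aq G SG).
split; last first.
  exists e, F; split=> //; apply: contra M0 => /eqP F0; apply/eqP/mpoly_eq0_eval => x.
  have := FM (cubd (\row_i x i)); rewrite F0 meval0 cubdK => ->.
  by apply: meval_eq => i; rewrite mxE.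
rewrite ZE; split.
  by have [t /generic_aligned [p /FA Fp _]] := sample_generic K; exists p.
move=> _ _ [S1 [h1 ->]] [S2 [h2 ->]] ZU.
have [|/existsNP [G1 /not_implyP [S1G1 nG1]]] :=
    EM (forall G, S1 G -> forall p, zvanish F p -> zvanish G p).
  by move=> h; left=> p Fp G SG; apply: h.
(* [G1] is an equation of the first set that is not zero on the whole hypersurface; its product with
   any equation [G2] of the second vanishes on the aligned cubics, and primality leaves [G2]. *)
right=> p Fp G2 SG2; have [H1 GH1] := coord_mpoly G1; have [H2 GH2] := coord_mpoly G2.
have [] : vanish_aligned H1 \/ vanish_aligned H2.
- apply: vanish_aligned_prime; apply: vanish_aligned_cubics => q aq f fq; rewrite mevalM.
  have [/(_ G1 S1G1) h|/(_ G2 SG2) h] := ZU q (FA q aq).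
    by rewrite GH1 h ?mul0r.
  by rewrite GH2 h ?mulr0.
- by move=> J1; case: nG1 => q; apply: FZ GH1 J1.
- by move=> J2; apply: FZ GH2 J2 Fp.
Qed.

End Closure.

Theorem theorem5p2 (R : realType) :
  zirreducible (zclosure (aligned_cubics R[i])) /\
  hypersurface (zclosure (aligned_cubics R[i])).
Proof.
exact: aligned_cubics_closure. Qed.
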